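(* Let $K$ be a field, let $\mathcal{P}$ be a discrete polymatroid on the ground set $[n]$, and let $\rho$ be its ground set rank function. Let $\mathcal{A}$ be the set of $\rho$-closed and $\rho$-inseparable subsets of $[n]$. Then the divisor class group $\mathrm{Cl}(R_{\mathcal{P}})$ is generated by the classes $[P_A]$ with $A\in\mathcal{A}$. Moreover, $\sum_{A\in\mathcal{A}}\rho(A)[P_A]=0$ is the only generating relation among these generators of $\mathrm{Cl}(R_{\mathcal{P}})$ (that is, $\mathrm{Cl}(R_{\mathcal{P}})$ is the quotient of the free abelian group on the symbols $[P_A]$, $A\in\mathcal{A}$, by the subgroup generated by $\sum_{A\in\mathcal{A}}\rho(A)[P_A]$). In particular, $\mathrm{Cl}(R_{\mathcal{P}})\cong\mathbb{Z}^{r-1}\oplus\mathbb{Z}/d\mathbb{Z}$, where $r=|\mathcal{A}|$ and $d=\gcd\{\rho(A) : A\in\mathcal{A}\}$.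
   Context: Notation: $[n]=\{1,\ldots,n\}$; $\mathbb{Z}_+$ is the set of non-negative integers; $\mathbf{e}_i$ are the standard basis vectors; $\mathbf{u}\le\mathbf{v}$ means $u_i\le v_i$ for all $i$; for $\mathbf{v}\in\mathbb{Z}^n$ and $A\subseteq[n]$, $\mathbf{v}(A)=\sum_{i\in A}v_i$ and $|\mathbf{v}|=\mathbf{v}([n])$. A multicomplex on $[n]$ is a nonempty finite set $\mathcal{M}\subset\mathbb{Z}_+^n$ closed under passing to smaller vectors of $\mathbb{Z}_+^n$ (with respect to $\le$) and containing $\mathbf{e}_1,\ldots,\mathbf{e}_n$. A discrete polymatroid on $[n]$ is a multicomplex $\mathcal{P}$ on $[n]$ such that if $\mathbf{v},\mathbf{w}\in\mathcal{P}$ and $|\mathbf{v}|<|\mathbf{w}|$, then there is $i\in[n]$ with $v_i<w_i$ and $\mathbf{v}+\mathbf{e}_i\in\mathcal{P}$. Its ground set rank function is $\rho(A)=\max\{\mathbf{v}(A) : \mathbf{v}\in\mathcal{P}\}$ for $A\subseteq[n]$. A nonempty set $A\subseteq[n]$ is $\rho$-closed if $\rho(A)<\rho(B)$ for all $B\subseteq[n]$ properly containing $A$; it is $\rho$-separable if $A=A_1\cup A_2$ with $A_1,A_2$ nonempty and disjoint and $\rho(A)=\rho(A_1)+\rho(A_2)$, and $\rho$-inseparable otherwise. The toric ring of $\mathcal{P}$ is $R_{\mathcal{P}}=K[\mathbf{x}^{\mathbf{v}}t : \mathbf{v}\in\mathcal{P}]\subset K[x_1,\ldots,x_n,t]$,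 where $\mathbf{x}^{\mathbf{v}}=\prod_i x_i^{v_i}$; it is a normal domain (Edmonds). For $A\in\mathcal{A}$, $P_A$ is the height one monomial prime ideal of $R_{\mathcal{P}}$ determined by the linear form $f_A(x)=-\sum_{i\in A}x_i+\rho(A)x_{n+1}$, i.e. $P_A=(\mathbf{x}^{\mathbf{v}}t : \mathbf{v}\in\mathcal{P},\ \mathbf{v}(A)<\rho(A))$. *)

(* Defs.v *)
From HB Require Import structures.
From mathcomp Require Import all_boot all_order all_algebra.
From mathcomp Require Import finmap boolp.
From mathcomp Require Import freeg mpoly.

Set Implicit Arguments.
Unset Strict Implicit.
Unset Printing Implicit Defensive.

Import GRing.Theory.

Local Open Scope ring_scope.
Local Open Scope quotient_scope.

(* Discrete polymatroids.  A vector of Z_+^n is an exponent vector of type    *)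
(* 'X_{1..n}, indexed by 'I_n = {0, ..., n-1}: v i is a coordinate,           *)
(* (v <= w)%MM is the coordinatewise order, U_(i)%MM is e_i, mdeg v is |v|.   *)

Definition multicomplex (n : nat) (M : {fset 'X_{1..n}}) : Prop :=
  [/\ M != fset0,
      (forall v w : 'X_{1..n}, w \in M -> (v <= w)%MM -> v \in M)
    & (forall i : 'I_n, U_(i)%MM \in M)].

Definition discrete_polymatroid (n : nat) (P : {fset 'X_{1..n}}) : Prop :=
  multicomplex P /\
  (forall v w : 'X_{1..n}, v \in P -> w \in P -> (mdeg v < mdeg w)%N ->
     exists i : 'I_n, (v i < w i)%N /\ (v + U_(i))%MM \in P).

Definition vsum (n : nat) (v : 'X_{1..n}) (A : {set 'I_n}) : nat :=
  (\sum_(i in A) v i)%N.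

Definition rho (n : nat) (P : {fset 'X_{1..n}}) (A : {set 'I_n}) : nat :=
  (\max_(v <- P) vsum v A)%N.

Definition rho_closed (n : nat) (P : {fset 'X_{1..n}}) (A : {set 'I_n}) : bool :=
  (A != set0) &&
  [forall B : {set 'I_n}, (A \proper B) ==> (rho P A < rho P B)%N].

Definition rho_separable (n : nat) (P : {fset 'X_{1..n}}) (A : {set 'I_n}) :
    bool :=
  [exists A1 : {set 'I_n}, exists A2 : {set 'I_n},
    [&& A == A1 :|: A2, A1 != set0, A2 != set0, [disjoint A1 & A2]
      & rho P A == (rho P A1 + rho P A2)%N]].

Definition closed_inseparable (n : nat) (P : {fset 'X_{1..n}}) :
    {set {set 'I_n}} :=
  [set A | rho_closed P A && ~~ rho_separable P A].

(* The divisor class group Cl(R) in terms of Weil divisors. *)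

Section ClassGroup.

Variable R : idomainType.

Definition ideal_span (S : {pred R}) : {pred R} := fun a =>
  `[< exists s : seq (R * R),
        all (fun x => x.2 \in S) s /\ a = \sum_(x <- s) x.1 * x.2 >].

Definition prime_ideal (I : {pred R}) : Prop :=
  idealr_closed I /\ prime_idealr_closed I.

Definition nonzero_ideal (I : {pred R}) : Prop := exists2 a, a \in I & a != 0.

(* As R is a domain, the height of a nonzero prime ideal I is 1 iff 0 is the  *)
(* only prime ideal properly contained in I.                                  *)
Definition height_one_prime (I : {pred R}) : Prop :=
  [/\ prime_ideal I, nonzero_ideal I
    & forall J : {pred R}, prime_ideal J -> nonzero_ideal J ->
        {subset J <= I} -> J =i I].

Definition prime_divisor : choiceType :=
  {I : R -> bool | `[< height_one_prime I >]}.

Definition weil_divisor : zmodType := {freeg prime_divisor / int}.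

Definition ideal_power (I : {pred R}) (k : nat) : {pred R} :=
  ideal_span (fun a =>
    `[< exists2 f : 'I_k -> R, forall i, f i \in I & a = \prod_(i < k) f i >]).

(* The contraction to R of the ideal I^k R_I of the localization R_I. *)
Definition symbolic_power (I : {pred R}) (k : nat) : {pred R} := fun a =>
  `[< exists2 s : R, s \notin I & s * a \in ideal_power I k >].

(* If R is a Noetherian normal domain and I is a height one prime ideal, then *)
(* R_I is a discrete valuation ring; the nonzero a has valuation k iff it is  *)
(* in I^k R_I but not in I^(k+1) R_I.                                         *)
Definition valuation_at (I : {pred R}) (a : R) (k : nat) : Prop :=
  a \in symbolic_power I k /\ a \notin symbolic_power I k.+1.

Definition is_div (a : R) (D : weil_divisor) : Prop :=
  forall I : prime_divisor,
    exists2 k : nat, valuation_at (val I) a k & coeff I D = k%:Z.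

(* The subgroup generated by the div(a) with a in R nonzero; it consists of   *)
(* the div(a/b) = div(a) - div(b), a/b a nonzero element of Frac(R).          *)
Definition principal_divisors : {pred weil_divisor} := fun D =>
  `[< forall S : {pred weil_divisor}, zmod_closed S ->
        (forall a E, a != 0 -> is_div a E -> E \in S) -> D \in S >].

Fact principal_divisors_zmod_closed : zmod_closed principal_divisors.
Proof.
split=> [|x y /asboolP hx /asboolP hy]; apply/asboolP => S hS gS.
  by case: hS.
by have [_ hB] := hS; apply: hB; [apply: hx | apply: hy].
Qed.

HB.instance Definition _ :=
  GRing.isZmodClosed.Build weil_divisor principal_divisors
    principal_divisors_zmod_closed.

Definition Cl : zmodType := {ideal_quot principal_divisors}.

(* The class [I]; the value is the junk 0 if I is not a height one prime. *)
Definition ideal_class (I : {pred R}) : Cl :=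
  \pi_Cl (if insub (I : R -> bool) is Some Q
          then << (Q : prime_divisor) >> else 0 : weil_divisor).

End ClassGroup.

(* Z/dZ for every d >= 0 (unlike 'Z_d, which is Z/2Z for d < 2). *)
Definition int_mod (d : nat) : zmodType :=
  {ideal_quot GRing.ZmodClosed.clone int (dvdz d%:Z) _}.

(* The toric ring.  In {mpoly K[n.+1]} the first n variables are the x_i and  *)
(* the last one, of index ord_max, is t.                                      *)

Section ToricRing.

Variables (K : fieldType) (n : nat) (P : {fset 'X_{1..n}}).

Definition toric_monomial (v : 'X_{1..n}) : {mpoly K[n.+1]} :=
  (\prod_(i < n) 'X_(widen_ord (leqnSn n) i) ^+ v i) * 'X_ord_max.

Definition in_toric_ring : {pred {mpoly K[n.+1]}} := fun f =>
  `[< forall S : {pred {mpoly K[n.+1]}}, GRing.subalg_closed S ->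
        (forall v, v \in P -> toric_monomial v \in S) -> f \in S >].

Fact in_toric_ring_subring_closed : GRing.subring_closed in_toric_ring.
Proof.
split=> [|x y /asboolP hx /asboolP hy|x y /asboolP hx /asboolP hy];
  apply/asboolP => S hS gS; have [S1 SD SM] := hS => //.
- have Sx := hx _ hS gS; have Sy := hy _ hS gS.
  by rewrite addrC -scaleN1r; apply: SD.
- by apply: SM; [apply: hx | apply: hy].
Qed.

HB.instance Definition _ :=
  GRing.isSubringClosed.Build {mpoly K[n.+1]} in_toric_ring
    in_toric_ring_subring_closed.

Record toric_ring := ToricRing {
  toric_val :> {mpoly K[n.+1]};
  _ : toric_val \in in_toric_ring }.

HB.instance Definition _ := [isSub for toric_val].
HB.instance Definition _ := [Choice of toric_ring by <:].
HB.instance Definition _ := [SubChoice_isSubComNzRing of toric_ring by <:].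

(* Inverses in toric_ring, needed by the idomainType interface. *)
Definition toric_unit : pred toric_ring := fun x =>
  `[< exists y : toric_ring, y * x = 1 >].

Definition toric_inv (x : toric_ring) : toric_ring :=
  if pselect (exists y : toric_ring, y * x = 1) is left h
  then projT1 (cid h) else x.

Fact toric_mulVx : {in toric_unit, left_inverse 1 toric_inv *%R}.
Proof.
move=> x /asboolP hx; rewrite /toric_inv; case: pselect => // h.
by case: (cid h).
Qed.

Fact toric_unitP (x y : toric_ring) : y * x = 1 -> toric_unit x.
Proof. by move=> h; apply/asboolP; exists y. Qed.

Fact toric_inv_out : {in [predC toric_unit], toric_inv =1 id}.
Proof. by move=> x /asboolP hx; rewrite /toric_inv; case: pselect. Qed.

HB.instance Definition _ :=
  GRing.ComNzRing_hasMulInverse.Build toric_ring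
    toric_mulVx toric_unitP toric_inv_out.

Fact toric_integral (x y : toric_ring) : x * y = 0 -> (x == 0) || (y == 0).
Proof.
move=> /(congr1 val); rewrite rmorphM rmorph0 => /eqP.
by rewrite mulf_eq0 !(inj_eq val_inj (_ : toric_ring) 0).
Qed.

HB.instance Definition _ :=
  GRing.ComUnitRing_isIntegral.Build toric_ring toric_integral.

Definition monomial_prime (A : {set 'I_n}) : {pred toric_ring} :=
  ideal_span (fun f : toric_ring =>
    `[< exists v : 'X_{1..n},
          [/\ v \in P, (vsum v A < rho P A)%N & val f = toric_monomial v] >]).

End ToricRing.

Arguments monomial_prime K {n} P A.

(* Main.v *)
Require Import Defs.
From HB Require Import structures.
From mathcomp Require Import all_boot all_order all_algebra.
From mathcomp Require Import finmap boolp.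
From mathcomp Require Import freeg mpoly.
From mathcomp Require Import zify ring.

(** Let T = K[x, t] be the ambient polynomial ring and R the toric ring.

  The lattice points of the cone over a polymatroid are sums of its vectors
  (polymatroid_decomposition, from the discrete sandwich theorem), and the cone is
  cut out by the linear forms f_A with A closed and inseparable
  (closed_inseparable_suffices). So R is spanned by the monomials on which all f_A
  are nonnegative (in_toric_ringP). No f_A is redundant (facet_interior), and
  since some variable has value - 1 at f_A there are monomials with any prescribed
  value at f_A and large values at all the others (facet_shift). Hence the least
  value of f_A on the terms of a polynomial is a discrete valuation centered at
  P_A, and the symbolic powers of P_A are its valuation ideals.

  Every polynomial is carried into R by a power of t, so R and T have the same
  localization at t. The height one primes of R come in two kinds. A prime that
  contains t contains some P_A, because a product of elements of all the P_A has a
  power divisible by t in R (prime_over_t). A prime that avoids t contains the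
  trace on R of the ideal of a prime g of T that does not divide t (prime_off_t),
  since T is factorial; the valuation of that trace is the multiplicity of g.

  Consequently div(t) is the sum of the rho(A) P_A, which is the relation, and a
  prime g made integral by a power of t has divisor its trace plus a combination
  of the P_A, so the classes [P_A] generate. Conversely, if a combination of the
  P_A is div(a) - div(b), then a and b have the same multiplicity at every prime of
  T that does not divide t, so a / b is a power of t up to a unit and the
  combination is a multiple of div(t) (only_rho_relation). The Smith normal form
  of the relation gives the last claim. *)

Set Implicit Arguments.
Unset Strict Implicit.
Unset Printing Implicit Defensive.

Import Order.TTheory GRing.Theory Num.Theory.

Local Open Scope ring_scope.

(** * The discrete sandwich theorem *)

Local Ltac bool_sets A B :=
  let x := fresh in apply/setP => x; rewrite !inE;
    case: eqP => _; case: (x \in A) (x \in B) => [] [].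

Section Sandwich.

Variable T : finType.
Implicit Types (A B : {set T}) (f g : {set T} -> int) (z : T -> int).

Definition submodular f := forall A B, f (A :|: B) + f (A :&: B) <= f A + f B.
Definition supermodular g := forall A B, g A + g B <= g (A :|: B) + g (A :&: B).

(** Contracting i after z i has been fixed: the two functions below are the
  bounds that remain for the values on the sets avoiding i. *)
Definition contract_upper f (i : T) (c : int) A : int :=
  Num.min (f (A :\ i)) (f (i |: A) - c).
Definition contract_lower g (i : T) (c : int) A : int :=
  Num.max (g (A :\ i)) (g (i |: A) - c).

(** Each of the four ways in which the minima for A and B can be attained is an
  instance of submodularity of f. *)
Lemma contract_upper_submodular f i c :
  submodular f -> submodular (contract_upper f i c).
Proof.
move=> sf A B; rewrite /contract_upper.
have h1 := sf (A :\ i) (B :\ i).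
have h2 := sf (A :\ i) (i |: B).
have h3 := sf (i |: A) (B :\ i).
have h4 := sf (i |: A) (i |: B).
have e1 : (A :|: B) :\ i = (A :\ i) :|: (B :\ i) by bool_sets A B.
have e2 : (A :&: B) :\ i = (A :\ i) :&: (B :\ i) by bool_sets A B.
have e3 : i |: (A :|: B) = (i |: A) :|: (i |: B) by bool_sets A B.
have e4 : i |: (A :&: B) = (i |: A) :&: (i |: B) by bool_sets A B.
have e5 : (A :\ i) :|: (i |: B) = i |: (A :|: B) by bool_sets A B.
have e6 : (A :\ i) :&: (i |: B) = (A :&: B) :\ i by bool_sets A B.
have e7 : (i |: A) :|: (B :\ i) = i |: (A :|: B) by bool_sets A B.
have e8 : (i |: A) :&: (B :\ i) = (A :&: B) :\ i by bool_sets A B.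
rewrite e5 e6 in h2; rewrite e7 e8 in h3; rewrite -e1 -e2 in h1.
rewrite -e3 -e4 in h4.
lia.
Qed.

Lemma contract_lower_supermodular g i c :
  supermodular g -> supermodular (contract_lower g i c).
Proof.
move=> sg A B.
have sf : submodular (fun A => - g A) by move=> X Y; have := sg X Y; lia.
have := contract_upper_submodular i (- c) sf A B.
rewrite /contract_upper /contract_lower; lia.
Qed.

(** Frank's discrete sandwich theorem, relative to the subsets of S so that the
  elements can be fixed one at a time. Uncrossing shows that every lower bound
  g (i |: A) - f A on z i lies below every upper bound f (i |: B) - g B; once z i
  is fixed between them, the contracted functions again satisfy the hypotheses. *)
Lemma discrete_sandwich f g (S : {set T}) :
    submodular f -> supermodular g -> f set0 = 0 -> g set0 = 0 ->
    (forall A, A \subset S -> g A <= f A) ->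
  exists z, forall A, A \subset S -> g A <= \sum_(i in A) z i <= f A.
Proof.
move: {2}#|S| (leqnn #|S|) => k; elim: k f g S => [|k IH] f g S.
  rewrite leqn0 cards_eq0 => /eqP-> _ _ f0 g0 _; exists (fun=> 0) => A.
  by rewrite subset0 => /eqP->; rewrite big_set0 f0 g0 lexx.
move=> leS sf sg f0 g0 gf.
have [S0|[i iS]] := set_0Vmem S.
  by apply: (IH f g S) => //; rewrite S0 cards0.
(* c, the future value of z i, is the largest of its lower bounds *)
have [c hc1 hc2] : exists2 c : int,
    forall A, A \subset S :\ i -> g (i |: A) - c <= f A
  & forall A, A \subset S :\ i -> g A <= f (i |: A) - c.
  pose F A : int := g (i |: A) - f A.
  have [A0 A0S A0max] := @arg_maxP _ _ _ set0 (fun A => A \subset S :\ i) F (sub0set _).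
  exists (F A0) => A AS; first by have := A0max _ AS; rewrite /F; lia.
  have iA : i \notin A by apply/negP => /(subsetP AS); rewrite !inE eqxx.
  have iA0 : i \notin A0 by apply/negP => /(subsetP A0S); rewrite !inE eqxx.
  have h1 := sf (i |: A) A0; have h2 := sg (i |: A0) A.
  have eU : (i |: A) :|: A0 = (i |: A0) :|: A by rewrite -!setUA (setUC A).
  have eI : (i |: A) :&: A0 = (i |: A0) :&: A.
    apply/setP => x; rewrite !inE; case: eqP => [->|_] /=.
      by rewrite (negbTE iA) (negbTE iA0).
    by rewrite andbC.
  rewrite eU eI in h1.
  have h3 : g ((i |: A0) :|: A) <= f ((i |: A0) :|: A).
    apply: gf; rewrite !subUset sub1set iS (subset_trans A0S) ?subD1set //=.
    by rewrite (subset_trans AS) ?subD1set.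
  have h4 : g ((i |: A0) :&: A) <= f ((i |: A0) :&: A).
    by apply: gf; rewrite subIset // (subset_trans AS) ?subD1set // orbT.
  rewrite /F; lia.
have D1 A : A \subset S :\ i -> A :\ i = A.
  move=> AS; apply/setP => x; rewrite !inE; case: eqP => //= ->.
  by apply/esym/negP => /(subsetP AS); rewrite !inE eqxx.
have e0 : (set0 : {set T}) :\ i = set0 by rewrite set0D.
have [||||||z hz] := IH (contract_upper f i c) (contract_lower g i c) (S :\ i).
- by move: leS; rewrite (cardsD1 i S) iS.
- exact: contract_upper_submodular.
- exact: contract_lower_supermodular.
- rewrite /contract_upper e0 f0; have := hc2 set0 (sub0set _); lia.
- rewrite /contract_lower e0 g0; have := hc1 set0 (sub0set _); lia.
- move=> A AS; rewrite /contract_upper /contract_lower (D1 _ AS).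
  have h1 := hc1 _ AS; have h2 := hc2 _ AS.
  have h3 : g A <= f A by apply: gf; rewrite (subset_trans AS) ?subD1set.
  have h4 : g (i |: A) <= f (i |: A).
    by apply: gf; rewrite subUset sub1set iS (subset_trans AS) ?subD1set.
  lia.
exists (fun j => if j == i then c else z j) => A AS.
have AiS : A :\ i \subset S :\ i by rewrite setSD.
have := hz _ AiS; rewrite /contract_upper /contract_lower (D1 _ AiS).
have sumE : \sum_(j in A :\ i) (if j == i then c else z j) = \sum_(j in A :\ i) z j.
  by apply: eq_bigr => j; rewrite !inE => /andP[/negbTE->].
have [iA|iA] := boolP (i \in A).
  rewrite (big_setD1 i iA) /= eqxx sumE setD1K // ge_max le_min.
  by move=> /andP[/andP[_ h1] /andP[_ h2]]; rewrite -lerBlDl h1 -lerBrDl.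
have -> : A :\ i = A by rewrite D1 // subsetD1 AS.
rewrite ge_max le_min => /andP[/andP[? _] /andP[? _]].
have -> : \sum_(j in A) (if j == i then c else z j) = \sum_(j in A) z j.
  by apply: eq_bigr => j jA; case: eqP => // ji; rewrite ji (negbTE iA) in jA.
by apply/andP.
Qed.

End Sandwich.

(** * Discrete polymatroids and their rank functions *)

Lemma bigmax_seq_attained (T : eqType) (s : seq T) (F : T -> nat) :
  s != [::] -> exists2 x, x \in s & (\max_(y <- s) F y = F x)%N.
Proof.
elim: s => // a s IH _; rewrite big_cons.
have [->|/IH[x xs ->]] := eqVneq s [::].
  by exists a; rewrite ?mem_head // big_nil maxn0.
have [le|lt] := leqP (F a) (F x); first by exists x; rewrite ?inE ?xs ?orbT //; lia.
by exists a; rewrite ?mem_head //; lia.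
Qed.

Section Vectors.

Variable n : nat.
Implicit Types (u v w : 'X_{1..n}) (A B C : {set 'I_n}).

Lemma vsumD v w A : vsum (v + w)%MM A = (vsum v A + vsum w A)%N.
Proof. by rewrite /vsum -big_split; apply: eq_bigr => i _; rewrite mnmDE. Qed.

Lemma vsum0 A : vsum 0%MM A = 0%N :> nat.
Proof. by rewrite /vsum big1 // => i _; rewrite mnm0E. Qed.

Lemma vsum_set0 v : vsum v set0 = 0%N.
Proof. exact: big_set0. Qed.

Lemma vsum_setT v : vsum v setT = mdeg v.
Proof. by rewrite /vsum mdegE; apply: eq_bigl => i; rewrite inE. Qed.

Lemma vsumU1 i A : vsum U_(i)%MM A = (i \in A).
Proof.
rewrite /vsum; case: (boolP (i \in A)) => iA.
  rewrite (big_setD1 i iA) /= mnm1E eqxx big1 // => j.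
  by rewrite !inE mnm1E eq_sym => /andP[/negbTE->].
by rewrite big1 // => j jA; rewrite mnm1E; case: eqP iA => // ->; rewrite jA.
Qed.

Lemma vsum_setD v A B : (vsum v A = vsum v (A :&: B) + vsum v (A :\: B))%N.
Proof. by rewrite /vsum (big_setID B). Qed.

Lemma vsumD1 v A i : i \in A -> vsum v A = (v i + vsum v (A :\ i))%N.
Proof. by move=> iA; rewrite /vsum (big_setD1 i iA). Qed.

Lemma vsum_setUI v A B :
  (vsum v (A :|: B) + vsum v (A :&: B) = vsum v A + vsum v B)%N.
Proof.
rewrite (vsum_setD v (A :|: B) B) (vsum_setD v A B).
have -> : (A :|: B) :&: B = B by apply/setIidPr/subsetUr.
by rewrite setDUl setDv setU0; lia.
Qed.

Lemma leq_vsum v w A : (forall i, i \in A -> v i <= w i)%N -> (vsum v A <= vsum w A)%N.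
Proof. by move=> vw; apply: leq_sum => i /vw. Qed.

Lemma eq_of_leq_vsum v w A : (forall i, i \in A -> v i <= w i)%N ->
  (vsum w A <= vsum v A)%N -> forall i, i \in A -> v i = w i.
Proof.
move=> vw le i iA; apply/eqP; rewrite eqn_leq vw //=.
move: le; rewrite !(vsumD1 _ iA).
have : (vsum v (A :\ i) <= vsum w (A :\ i))%N.
  by apply: leq_vsum => j; rewrite inE => /andP[_ /vw].
lia.
Qed.

Lemma vsum_subset v A B : A \subset B -> (vsum v A <= vsum v B)%N.
Proof. by move=> /setIidPr AB; rewrite (vsum_setD v B A) AB leq_addr. Qed.

Definition restrict v A : 'X_{1..n} := [multinom if i \in A then v i else 0%N | i < n].

Lemma restrictE v A i : restrict v A i = if i \in A then v i else 0%N.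
Proof. by rewrite mnmE. Qed.

Lemma restrict_le v A : (restrict v A <= v)%MM.
Proof. by apply/mnm_lepP => i; rewrite restrictE; case: ifP. Qed.

Lemma vsum_restrict v A B : vsum (restrict v A) B = vsum v (B :&: A).
Proof.
rewrite (vsum_setD _ B A) addnC {1}/vsum big1 => [|i]; last first.
  by rewrite !inE restrictE => /andP[/negbTE->].
by apply: eq_bigr => i; rewrite !inE restrictE => /andP[_ ->].
Qed.

Lemma mdeg_restrict v A : mdeg (restrict v A) = vsum v A.
Proof. by rewrite -vsum_setT vsum_restrict setTI. Qed.

End Vectors.

Section Polymatroid.

Variables (n : nat) (P : {fset 'X_{1..n}}).
Hypothesis hP : discrete_polymatroid P.
Implicit Types (u v w a : 'X_{1..n}) (A B C : {set 'I_n}).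

Lemma polymatroid_le v w : w \in P -> (v <= w)%MM -> v \in P.
Proof. by have [[_ + _] _] := hP; apply. Qed.

Lemma polymatroid_U i : U_(i)%MM \in P.
Proof. by have [[]] := hP. Qed.

Lemma polymatroid0 : 0%MM \in P.
Proof.
have [[/fset0Pn[v vP] _ _] _] := hP.
by apply: polymatroid_le vP _; apply/mnm_lepP => i; rewrite mnm0E.
Qed.

Lemma restrict_in v A : v \in P -> restrict v A \in P.
Proof. by move/polymatroid_le; apply; apply: restrict_le. Qed.

Lemma vsum_le_rho v A : v \in P -> (vsum v A <= rho P A)%N.
Proof. by move=> vP; apply: leq_bigmax_seq. Qed.

Lemma rho_attained A : exists2 v, v \in P & vsum v A = rho P A.
Proof.
have [|v vP e] := @bigmax_seq_attained _ (P : seq 'X_{1..n}) (fun v => vsum v A).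
  by apply/eqP => e; have := polymatroid0; rewrite -[_ \in P]/(_ \in (P : seq _)) e.
by exists v; rewrite ?/rho ?e.
Qed.

Lemma rho_set0 : rho P set0 = 0%N.
Proof. by have [v _ <-] := rho_attained set0; rewrite vsum_set0. Qed.

Lemma rho_subset A B : A \subset B -> (rho P A <= rho P B)%N.
Proof.
move=> AB; have [v vP <-] := rho_attained A.
exact: leq_trans (vsum_subset v AB) (vsum_le_rho B vP).
Qed.

Lemma rho_gt0 A : A != set0 -> (0 < rho P A)%N.
Proof.
case/set0Pn => i iA; apply: leq_trans (vsum_le_rho A (polymatroid_U i)).
by rewrite vsumU1 iA.
Qed.

(** Repeated exchange: v grows to the size of w inside the join of v and w. *)
Lemma polymatroid_augment v w : v \in P -> w \in P -> (mdeg v <= mdeg w)%N ->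
  exists v', [/\ v' \in P, (v <= v')%MM, mdeg v' = mdeg w
               & forall i, (v' i <= maxn (v i) (w i))%N].
Proof.
move=> vP wP; move: {2}(mdeg w - mdeg v)%N (erefl (mdeg w - mdeg v)%N) => k.
elim: k v vP => [|k IH] v vP ek le.
  exists v; split=> //; [exact/mnm_lepP | lia|move=> i; exact: leq_maxl].
have [|i [lti vi]] := hP.2 v w vP wP; first by lia.
have [||v' [v'P le' dv' m']] := IH _ vi; rewrite ?mdegD ?mdeg1; try lia.
exists v'; split=> // [|j].
  apply/mnm_lepP => j; move/mnm_lepP/(_ j): le'; rewrite mnmDE; lia.
have := m' j; rewrite mnmDE mnm1E; case: eqP => [<-|_]; lia.
Qed.

(** The greedy algorithm: a vector that is maximal on C grows to one that is
  maximal on A, and can only keep its weight on C. *)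
Lemma rho_chain_attained C A : C \subset A ->
  exists v, [/\ v \in P, vsum v C = rho P C & vsum v A = rho P A].
Proof.
move=> CA; have [v vP vC] := rho_attained C; have [w wP wA] := rho_attained A.
have [|u [uP /mnm_lepP le du mu]] :=
  polymatroid_augment (restrict_in C vP) (restrict_in A wP).
  by rewrite !mdeg_restrict vC wA rho_subset.
exists u; split=> //; apply/eqP; rewrite eqn_leq vsum_le_rho //=.
  rewrite -vC; apply: leq_vsum => i iC; apply: leq_trans (le i).
  by rewrite restrictE iC.
rewrite -wA -(mdeg_restrict w) -du -vsum_setT (vsum_setD u _ A) setTI.
rewrite [X in (_ + X)%N]/vsum big1 ?addn0 // => i; rewrite !inE andbT => iA.
apply/eqP; rewrite -leqn0; apply: leq_trans (mu i) _; rewrite !restrictE.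
by rewrite (negbTE iA); case: ifP => // /(subsetP CA); rewrite (negbTE iA).
Qed.

(** A vector that is greedy for the intersection and then for the union has
  exactly the weight of the left-hand side on A and B together. *)
Lemma rho_submodular A B :
  (rho P (A :|: B) + rho P (A :&: B) <= rho P A + rho P B)%N.
Proof.
have [|v [vP <- <-]] := @rho_chain_attained (A :&: B) (A :|: B).
  by rewrite subIset // subsetUl.
by rewrite vsum_setUI leq_add // vsum_le_rho.
Qed.

(** Edmonds's description of P by its rank function. Let u be maximal in P below
  v and let C be the set of the directions in which u cannot grow inside P. Then
  u is greedy on C: otherwise some vector with i in C grows from the restriction
  of u, and completing it by exchanges with u gives u + e_i - e_j with j not in
  C; exchanging that with u + e_j puts u + e_i into P, against i in C. If u were
  not v, then C would contain an i with u i < v i, and v would exceed u, and so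
  rho, on C. *)
Theorem polymatroidP v : (v \in P) <-> forall A, (vsum v A <= rho P A)%N.
Proof.
split=> [vP A|vle]; first exact: vsum_le_rho.
pose below u := (u \in P) && [forall i, (u i <= v i)%N].
have [u /andP[uP /forallP uv] umax] :
    exists2 u, below u & forall w, below w -> (mdeg w <= mdeg u)%N.
  have ex : exists k, `[< exists2 u, below u & mdeg u = k >].
    exists 0%N; apply/asboolP; exists 0%MM; rewrite ?mdeg0 //.
    by rewrite /below polymatroid0; apply/forallP => i; rewrite mnm0E.
  have bd k : `[< exists2 u, below u & mdeg u = k >] -> (k <= mdeg v)%N.
    move=> /asboolP[u /andP[_ /forallP uv] <-]; rewrite !mdegE.
    by apply: leq_sum => i _.
  case: (ex_maxnP ex bd) => k /asboolP[u bu <-] max; exists u => // w bw.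
  by apply: max; apply/asboolP; exists w.
pose C := [set i | (u + U_(i))%MM \notin P].
have stuck i : (u i < v i)%N -> i \in C.
  move=> lti; rewrite inE; apply/negP => uiP.
  have /negP[] : ~~ below (u + U_(i))%MM.
    by apply/negP => /umax; rewrite mdegD mdeg1 addn1 ltnn.
  rewrite /below uiP; apply/forallP => j; rewrite mnmDE mnm1E; have := uv j.
  by case: eqP => [<-|_]; lia.
have uC : vsum u C = rho P C.
  apply/eqP; rewrite eqn_leq vsum_le_rho //= leqNgt; apply/negP => lt.
  have [w wP wC] := rho_attained C.
  have [|i []] := hP.2 _ _ (restrict_in C uP) (restrict_in C wP).
    by rewrite !mdeg_restrict wC.
  rewrite !restrictE; case: ifP => // iC _ u'P.
  have uCdeg : (mdeg u = vsum u C + vsum u (~: C))%N.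
    by rewrite -vsum_setT (vsum_setD u _ C) setTI setTD.
  have [le|gt] := leqP (mdeg u) (vsum u C).
    (* then u vanishes off C and equals its restriction *)
    have eu : u = restrict u C.
      apply/mnmP => j; rewrite restrictE; case: ifP => // jC.
      have : (vsum u (~: C) <= 0)%N by lia.
      rewrite leqn0 sum_nat_eq0 => /forallP/(_ j).
      by rewrite inE jC => /eqP.
    by move: iC; rewrite inE {1}eu u'P.
  have [|w' [w'P /mnm_lepP w'ge dw' w'le]] := polymatroid_augment u'P uP.
    by rewrite mdegD mdeg1 mdeg_restrict addn1.
  have w'C j : j \in C -> w' j = (u j + (i == j))%N.
    move=> jC; have := w'ge j; have := w'le j.
    rewrite !mnmDE !mnm1E !restrictE jC; lia.
  have w'nC j : j \notin C -> (w' j <= u j)%N.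
    move=> jC; have := w'le j; rewrite mnmDE mnm1E restrictE (negbTE jC).
    have [ij|_] := eqVneq i j; first by rewrite -ij iC in jC.
    lia.
  have w'sC : vsum w' C = (vsum u C).+1.
    have -> : vsum w' C = vsum (u + U_(i))%MM C.
      by apply: eq_bigr => j jC; rewrite mnmDE mnm1E w'C.
    by rewrite vsumD vsumU1 iC addn1.
  have w'deg : (mdeg w' = vsum w' C + vsum w' (~: C))%N.
    by rewrite -vsum_setT (vsum_setD w' _ C) setTI setTD.
  have w'sD : ((vsum w' (~: C)).+1 = vsum u (~: C))%N by lia.
  have [j jC w'j] : exists2 j, j \notin C & (w' j < u j)%N.
    have [/exists_inP[j jC lj]|/exists_inPn h] :=
      boolP [exists j in ~: C, (w' j < u j)%N].
      by exists j => //; rewrite inE in jC.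
    suff : (vsum u (~: C) <= vsum w' (~: C))%N by lia.
    by apply: leq_vsum => k /h; rewrite -leqNgt.
  (* w' + U_(j) and u agree off C: they are comparable of equal weight there *)
  have w'jE k : k \notin C -> (w' k + (j == k))%N = u k.
    move=> kC; rewrite -mnm1E -mnmDE; apply: (@eq_of_leq_vsum _ _ _ (~: C)).
    - move=> l; rewrite inE mnmDE mnm1E => /w'nC.
      by case: eqP => [<-|_]; lia.
    - by rewrite vsumD vsumU1 inE jC; lia.
    - by rewrite inE.
  have ujP : (u + U_(j))%MM \in P by move: jC; rewrite inE negbK.
  have [|k [ltk w'kP]] := hP.2 _ _ w'P ujP; first by rewrite mdegD mdeg1; lia.
  have kj : k = j.
    apply/eqP; apply: contraLR ltk => kj; rewrite -leqNgt mnmDE mnm1E.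
    rewrite eq_sym (negbTE kj) addn0; have [kC|kC] := boolP (k \in C).
      by rewrite w'C // leq_addr.
    by rewrite -(w'jE _ kC) eq_sym (negbTE kj) addn0.
  move: (iC); rewrite inE => /negP[]; apply: polymatroid_le w'kP _.
  apply/mnm_lepP => l; rewrite kj !mnmDE !mnm1E.
  have [lC|lC] := boolP (l \in C); first by rewrite (w'C _ lC) leq_addr.
  rewrite (w'jE _ lC); have [il|_] := eqVneq i l; last by rewrite addn0.
  by rewrite -il iC in lC.
have [/forallP vu|/forallPn[i]] := boolP [forall i, (v i <= u i)%N].
  by apply: polymatroid_le uP _; apply/mnm_lepP.
rewrite -ltnNge => lti; have iC := stuck i lti.
have := @eq_of_leq_vsum _ u v C (fun j _ => uv j).
by rewrite uC vle => /(_ isT i iC) e; rewrite e ltnn in lti.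
Qed.

End Polymatroid.

(** * Integer decomposition and the facets of a polymatroid *)

Section Decomposition.

Variables (n : nat) (P : {fset 'X_{1..n}}).
Hypothesis hP : discrete_polymatroid P.
Implicit Types (u v w a : 'X_{1..n}) (A B C : {set 'I_n}).
Let AA := closed_inseparable P.

Lemma Posz_vsum v A : (vsum v A)%:Z = \sum_(i in A) (v i)%:Z.
Proof. exact: (big_morph Posz PoszD). Qed.

Lemma vsum_sum (I : Type) (r : seq I) (F : I -> 'X_{1..n}) A :
  vsum (\sum_(j <- r) F j)%MM A = (\sum_(j <- r) vsum (F j) A)%N.
Proof. exact: (big_morph (fun v => vsum v A) (fun u v => vsumD u v A) (vsum0 A)). Qed.

(** The rank function lies above a - b rho, and the sandwich theorem puts an
  additive z between them. Truncating z to the interval from 0 to a gives v: on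
  any set, the coordinates at which the truncation is active can be discarded. *)
Lemma polymatroid_split a b : (forall A, vsum a A <= b.+1 * rho P A)%N ->
  exists v, [/\ v \in P, (v <= a)%MM
              & forall A, (vsum (a - v)%MM A <= b * rho P A)%N].
Proof.
move=> ab; pose f A : int := (rho P A)%:Z.
pose g A : int := (vsum a A)%:Z - (b * rho P A)%:Z.
have sf : submodular f by move=> A B; have := rho_submodular hP A B; rewrite /f; lia.
have sg : supermodular g.
  move=> A B; rewrite /g; have := vsum_setUI a A B.
  have := rho_submodular hP A B; nia.
have f0 : f set0 = 0 by rewrite /f rho_set0.
have g0 : g set0 = 0 by rewrite /g rho_set0 // vsum_set0 muln0.
have gf A : A \subset setT -> g A <= f A.
  by move=> _; rewrite /g /f; have := ab A; lia.
have [z hz] := discrete_sandwich sf sg f0 g0 gf.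
pose v : 'X_{1..n} := [multinom minn (a i) `|Num.max (0 : int) (z i)|%N | i < n].
exists v; split.
- apply/polymatroidP => // A.
  pose A' := [set i in A | 0 < z i].
  have A'A : A' \subset A by apply/subsetP => i; rewrite inE => /andP[].
  apply: leq_trans (rho_subset hP A'A).
  have -> : vsum v A = vsum v A'.
    rewrite (vsum_setD v A A') (setIidPr A'A) [X in (_ + X)%N]/vsum big1 ?addn0 // => i.
    by rewrite !inE mnmE => /andP[/nandP[/negP//|zi] iA]; lia.
  have /andP[_] := hz A' (subsetT _); rewrite /f -lez_nat; apply: le_trans.
  rewrite Posz_vsum; apply: ler_sum => i; rewrite inE mnmE => /andP[_ zi]; lia.
- by apply/mnm_lepP => i; rewrite mnmE geq_minl.
- move=> A; pose A' := [set i in A | (v i < a i)%N].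
  have A'A : A' \subset A by apply/subsetP => i; rewrite inE => /andP[].
  apply: (@leq_trans (b * rho P A')); last by rewrite leq_mul2l (rho_subset hP) ?orbT.
  have -> : vsum (a - v)%MM A = vsum (a - v)%MM A'.
    rewrite (vsum_setD _ A A') (setIidPr A'A) [X in (_ + X)%N]/vsum big1 ?addn0 // => i.
    by rewrite !inE mnmBE => /andP[/nandP[/negP//|zi] iA]; lia.
  have /andP[+ _] := hz A' (subsetT _); rewrite /g => gz.
  suff : (vsum (a - v)%MM A')%:Z <= (vsum a A')%:Z - \sum_(i in A') z i.
    move=> le; rewrite -lez_nat; apply: le_trans le _.
    by rewrite lerBlDr -lerBlDl.
  rewrite !Posz_vsum -sumrB; apply: ler_sum => i.
  by rewrite inE mnmBE !mnmE => /andP[_]; lia.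
Qed.

(** The integer decomposition property, to which the toric ring owes its
  normality. *)
Theorem polymatroid_decomposition a b :
    (forall A, vsum a A <= b * rho P A)%N ->
  exists s : seq 'X_{1..n},
    [/\ size s = b, {in s, forall v, v \in P} & a = (\sum_(v <- s) v)%MM].
Proof.
elim: b a => [|b IH] a ab.
  exists [::]; split=> //; rewrite big_nil; apply/eqP; rewrite -mdeg_eq0.
  by rewrite -vsum_setT -leqn0 -(mul0n (rho P setT)).
have [v [vP va /IH[s [ss sP e]]]] := polymatroid_split ab.
exists (v :: s); split; first by rewrite /= ss.
  by move=> w; rewrite inE => /predU1P[->//|/sP].
by rewrite big_cons -e addmC submK.
Qed.

Lemma rho_closedP A : A \in AA ->
  A != set0 /\ forall B, A \proper B -> (rho P A < rho P B)%N.
Proof.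
rewrite inE => /andP[/andP[-> /forallP h] _]; split=> // B.
by move/(implyP (h B)).
Qed.

Lemma rho_inseparable A B : A \in AA -> B \proper A -> B != set0 ->
  (rho P A < rho P B + rho P (A :\: B))%N.
Proof.
rewrite inE => /andP[_ /existsPn/(_ B)/existsPn/(_ (A :\: B)) nsep] BA B0.
have ADB : A :\: B != set0 by rewrite setD_eq0; case/andP: BA.
have eA : B :|: A :\: B = A by rewrite -{1}(setIidPr (proper_sub BA)) setID.
have dis : [disjoint B & A :\: B].
  by rewrite -setI_eq0; apply/eqP/setP => i; rewrite !inE; case: (i \in B).
move: nsep; rewrite eA eqxx B0 ADB dis /= => neq.
have := rho_submodular hP B (A :\: B); rewrite eA.
by rewrite (disjoint_setI0 dis) rho_set0 // addn0 leq_eqVlt (negbTE neq).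
Qed.

(** A set that is not closed lies in a larger one of the same rank, a separable
  one splits into two of smaller rank, and both steps decrease rho(A) * (n + 1) + (n - |A|). *)
Lemma closed_inseparable_suffices a b :
  (forall A, A \in AA -> vsum a A <= b * rho P A)%N ->
  forall A, (vsum a A <= b * rho P A)%N.
Proof.
move=> hb A.
move: {2}(rho P A * n.+1 + (n - #|A|))%N (leqnn (rho P A * n.+1 + (n - #|A|))).
move=> k; elim: k A => [|k IH] A le.
all: have [->|A0] := eqVneq A set0; rewrite ?vsum_set0 //.
  by have := rho_gt0 hP A0; nia.
have cardn B : (#|B| <= n)%N by rewrite -[leqRHS]card_ord max_card.
have [AAA|] := boolP (A \in AA); first exact: hb.
rewrite inE negb_and negbK /rho_closed A0 /= => /orP[/forallPn[B]|].
  rewrite negb_imply -leqNgt => /andP[AB rBA].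
  have rAB : (rho P A <= rho P B)%N by rewrite (rho_subset hP) ?proper_sub.
  have eAB : rho P A = rho P B by lia.
  apply: leq_trans (vsum_subset a (proper_sub AB)) _; rewrite eAB; apply: IH.
  have := proper_card AB; have := cardn B; rewrite -eAB; lia.
case/existsP => A1 /existsP[A2 /and5P[/eqP eA A10 A20 dis /eqP er]].
have r1 := rho_gt0 hP A10; have r2 := rho_gt0 hP A20.
have := IH A1 _; have := IH A2 _; have := vsum_setUI a A1 A2.
rewrite (disjoint_setI0 dis) vsum_set0 -eA er; have := cardn A1; have := cardn A2.
have := cardn A.
move=> c c2 c1 e h1 h2.
by rewrite -(addn0 (vsum a A)) e mulnDr leq_add // (h1, h2) //; nia.
Qed.

(** Otherwise every vector would satisfy the bounds with b = 0. *)
Lemma closed_inseparable_neq0 : (0 < n)%N -> AA != set0.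
Proof.
move=> n_gt0; apply/eqP => e; pose i := Ordinal n_gt0.
have := @closed_inseparable_suffices U_(i)%MM 0 _ [set i].
by rewrite vsumU1 inE eqxx mul0n => h; suff : false; [|apply: h => A; rewrite e inE].
Qed.

(** If B is not inside A, a vector supported on A works, for otherwise A and its
  union with B would have the same rank; if B is a proper subset of A, a vector that is greedy on
  the complement of B in A works, as A is inseparable. *)
Lemma facet_separation A B : A \in AA -> B \in AA -> A != B ->
  exists v, [/\ v \in P, vsum v A = rho P A & (vsum v B < rho P B)%N].
Proof.
move=> AAA BAA neAB; have [A0 clA] := rho_closedP AAA; have [B0 _] := rho_closedP BAA.
have [BA|nBA] := boolP (B \subset A).
  have BpA : B \proper A by rewrite properEneq eq_sym neAB BA.
  have [v [vP v1 v2]] := rho_chain_attained hP (subsetDl A B).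
  exists v; split=> //.
  have := rho_inseparable AAA BpA B0; have := vsum_setD v A B.
  rewrite (setIidPr BA); lia.
have [v vP vA] := rho_attained hP A.
exists (restrict v A); split; first exact: restrict_in.
  by rewrite vsum_restrict setIid.
rewrite vsum_restrict ltnNge; apply/negP => le.
have := vsum_le_rho (B :&: A) vP; have := rho_submodular hP A B; rewrite setIC.
have : (rho P A < rho P (A :|: B))%N.
  apply: clA; rewrite properE subsetUl /=; apply: contra nBA.
  exact: subset_trans (subsetUr A B).
lia.
Qed.

(** An integer point of the relative interior of the facet of A in the cone
  over the polymatroid: the sum of vectors that separate A from each of the
  other sets. *)
Lemma facet_interior A : A \in AA ->
  exists q b, [/\ vsum q A = (b * rho P A)%N,
                  forall B, B \in AA -> B != A -> (vsum q B < b * rho P B)%N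
                & exists2 i, i \in A & (0 < q i)%N].
Proof.
move=> AAA.
have [|F hF] := @fin_all_exists {set 'I_n} (fun=> 'X_{1..n})
  (fun B v => [/\ v \in P, vsum v A = rho P A
                & B \in AA -> B != A -> (vsum v B < rho P B)%N]).
  move=> B; have [/andP[BAA BA]|nB] := boolP ((B \in AA) && (B != A)).
    by have [|v [vP vA vB]] := facet_separation AAA BAA; [rewrite eq_sym|exists v].
  have [v vP vA] := rho_attained hP A; exists v; split=> // BAA BA.
  by rewrite BAA BA in nB.
pose q := (\sum_(B : {set 'I_n}) F B)%MM; pose b := #|{set 'I_n}|.
have qA : vsum q A = (b * rho P A)%N.
  rewrite vsum_sum -sum_nat_const; apply: eq_bigr => B _.
  by have [] := hF B.
exists q, b; split=> // [B BAA BA|].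
  rewrite vsum_sum -sum_nat_const (bigD1 B) //= [ltnRHS](bigD1 B) //=.
  have [_ _ /(_ BAA BA) lt] := hF B.
  apply: (leq_add (m1 := (vsum (F B) B).+1)) => //; apply: leq_sum => C _.
  by have [/(@vsum_le_rho _ _ _ B)] := hF C.
have [/exists_inP[i]|/exists_inPn h] := boolP [exists i in A, (0 < q i)%N].
  by exists i.
have [A0 _] := rho_closedP AAA.
have : (0 < vsum q A)%N.
  by rewrite qA muln_gt0 (rho_gt0 hP A0) andbT /b; apply/card_gt0P; exists set0.
rewrite /vsum big1 // => i /h; lia.
Qed.

End Decomposition.

(** * Factorial domains *)

Section Factorial.

Variable D : idomainType.
Implicit Types (a b c p q u x y : D) (s : seq D).

Definition divides a b : Prop := exists c, b = c * a.

Definition prime_elt p : Prop :=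
  [/\ p != 0, p \isn't a GRing.unit
    & forall a b, divides p (a * b) -> divides p a \/ divides p b].

Definition factors_to_primes a : Prop := exists u s,
  [/\ u \is a GRing.unit, {in s, forall p, prime_elt p}
    & a = u * \prod_(p <- s) p].

Definition factorial_domain : Prop := forall a, a != 0 -> factors_to_primes a.

Lemma dividesxx a : divides a a.
Proof. by exists 1; rewrite mul1r. Qed.

Lemma divides0 a : divides a 0.
Proof. by exists 0; rewrite mul0r. Qed.

Lemma divides_mull a b c : divides a b -> divides a (c * b).
Proof. by case=> d ->; exists (c * d); rewrite mulrA. Qed.

Lemma divides_mulr a b c : divides a b -> divides a (b * c).
Proof. by rewrite mulrC; apply: divides_mull. Qed.

Lemma dividesD a b c : divides a b -> divides a c -> divides a (b + c).
Proof. by move=> [d ->] [e ->]; exists (d + e); rewrite mulrDl. Qed.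

Lemma dividesN a b : divides a b -> divides a (- b).
Proof. by move=> [d ->]; exists (- d); rewrite mulNr. Qed.

Lemma dividesDr a b c : divides a b -> divides a (b + c) -> divides a c.
Proof. by move=> ab /(dividesD (dividesN ab)); rewrite addKr. Qed.

Lemma divides_sum a (I : Type) (r : seq I) (Q : pred I) (F : I -> D) :
  (forall i, Q i -> divides a (F i)) -> divides a (\sum_(i <- r | Q i) F i).
Proof.
by move=> h; elim/big_ind: _ => [|x y|i /h//]; [apply: divides0|apply: dividesD].
Qed.

Lemma divides_trans a b c : divides a b -> divides b c -> divides a c.
Proof. by move=> [d ->] [e ->]; exists (e * d); rewrite mulrA. Qed.

Lemma divides_unit a u : u \is a GRing.unit -> divides a u -> a \is a GRing.unit.
Proof. by move=> uU [c e]; move: uU; rewrite e unitrM => /andP[]. Qed.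

Lemma prime_not_divides_unit p u :
  prime_elt p -> u \is a GRing.unit -> ~ divides p u.
Proof. by move=> [_ /negP pU _] uU /(divides_unit uU). Qed.

Lemma prime_divides_prod p s : prime_elt p -> divides p (\prod_(x <- s) x) ->
  exists2 x, x \in s & divides p x.
Proof.
move=> pp; elim: s => [|x s IH]; rewrite ?big_nil ?big_cons.
  by move/prime_not_divides_unit => /(_ pp (unitr1 _)).
have [_ _ h] := pp => /h[px|/IH[y ys py]]; first by exists x; rewrite ?mem_head.
by exists y; rewrite // inE ys orbT.
Qed.

Lemma prime_divides_prime p q : prime_elt p -> prime_elt q -> divides p q ->
  exists2 u, u \is a GRing.unit & q = u * p.
Proof.
move=> pp [q0 qU hq] [c e]; exists c => //.
have [//|[d ed]] : divides q c \/ divides q p by apply: hq; rewrite -e; apply: dividesxx.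
  move=> [d ed]; case: pp => p0 /negP[]; apply/unitrPr; exists d.
  apply: (mulfI q0); rewrite mulr1 {2}e ed; ring.
apply/unitrPr; exists d; apply: (mulfI q0); rewrite mulr1 {2}e ed; ring.
Qed.

Lemma factors_to_primes_unit u : u \is a GRing.unit -> factors_to_primes u.
Proof. by move=> uU; exists u, [::]; rewrite big_nil mulr1. Qed.

Lemma factors_to_primes_prime p : prime_elt p -> factors_to_primes p.
Proof.
move=> pp; exists 1, [:: p]; rewrite big_seq1 mul1r unitr1; split=> //.
by move=> q; rewrite inE => /eqP->.
Qed.

Lemma factors_to_primesM a b :
  factors_to_primes a -> factors_to_primes b -> factors_to_primes (a * b).
Proof.
move=> [u [s [uU sp ->]]] [v [t [vU tp ->]]]; exists (u * v), (s ++ t).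
rewrite unitrM uU vU big_cat /=; split=> // [p|]; last by ring.
by rewrite mem_cat => /orP[/sp|/tp].
Qed.

(** A prime that divides the product of b and its cofactor without dividing b
  divides the cofactor, so the primes of s can be cancelled one by one. *)
Lemma divides_cancel a b s : {in s, forall p, prime_elt p} ->
  {in s, forall p, ~ divides p b} ->
  divides b (\prod_(p <- s) p * a) -> divides b a.
Proof.
elim: s => [|p s IH] sp sb; first by rewrite big_nil mul1r.
have pp : prime_elt p by apply: sp; rewrite mem_head.
have [p0 _ hp] := pp.
rewrite big_cons -mulrA => -[c e].
have [[d ed]|/sb] : divides p c \/ divides p b.
- by apply: hp; rewrite -e; apply: divides_mulr (dividesxx p).
- apply: IH => [q qs|q qs|]; [apply: sp|apply: sb|]; rewrite ?inE ?qs ?orbT //.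
  exists d; apply: (mulfI p0); rewrite e ed; ring.
by rewrite mem_head => /(_ isT).
Qed.

End Factorial.

Section PolyFactorial.

Variable D : idomainType.
Implicit Types (p c : D) (f g h : {poly D}).

Lemma divides_polyC p f : divides p%:P f <-> forall i, divides p f`_i.
Proof.
split=> [[g ->] i|h].
  by rewrite coefMC; exists g`_i.
pose F i := projT1 (cid (h i)); have FE i : f`_i = F i * p by rewrite /F; case: cid.
exists (\poly_(i < size f) F i); apply/polyP => i; rewrite coefMC coef_poly.
by case: ltnP => [_|le]; [apply: FE | rewrite nth_default // mul0r].
Qed.

(** Gauss's lemma: the first coefficients of f and g that p does not divide
  contribute to their product a coefficient that p does not divide. *)
Lemma prime_polyC p : prime_elt p -> prime_elt p%:P.
Proof.
move=> [p0 pU hp]; split=> [||f g].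
- by rewrite polyC_eq0.
- by rewrite poly_unitE coefC /= negb_and pU orbT.
rewrite !divides_polyC => dfg.
have first h : (forall i, divides p h`_i) \/
    exists i, ~ divides p h`_i /\ forall j, (j < i)%N -> divides p h`_j.
  have [H|/existsNP[i ni]] := pselect (forall i, divides p h`_i); first by left.
  right; have ex : exists i, ~~ `[< divides p h`_i >] by exists i; apply/asboolPn.
  case: (ex_minnP ex) => k /asboolPn nk mk; exists k; split=> // j jk.
  by apply: contrapT => /asboolPn /mk; rewrite leqNgt jk.
have [?|[i [ni hi]]] := first f; first by left.
have [?|[j [nj hj]]] := first g; first by right.
have := dfg (i + j)%N; rewrite coefM.
have lti : (i < (i + j).+1)%N by rewrite ltnS leq_addr.
rewrite (bigD1 (Ordinal lti)) //= addKn addrC => dij.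
suff /dividesDr/(_ dij)/hp[] :
  divides p (\sum_(k < (i + j).+1 | k != Ordinal lti) f`_k * g`_(i + j - k)) by [].
apply: divides_sum => k; rewrite -val_eqE /= neq_ltn => /orP[lt|gt].
  by apply: divides_mulr; apply: hi.
by apply: divides_mull; apply: hj; rewrite ltn_subLR ?ltn_add2r // -ltnS.
Qed.

Hypothesis hD : factorial_domain D.

Definition primitive f : Prop := forall p, prime_elt p -> ~ divides p%:P f.

(** Every prime constant taken out of f removes one prime factor from its leading
  coefficient, which has finitely many of them. *)
Lemma content_primitive f : f != 0 ->
  exists c g, [/\ c != 0, f = c *: g & primitive g].
Proof.
move=> f0; have := hD (a := lead_coef f); rewrite lead_coef_eq0 => /(_ f0).
move=> [u [s [uU sp e]]].
have [k] := ubnP (size s); elim: k u s f uU sp e f0 => // k IH u s f uU sp e f0 lek.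
have [pf|] := pselect (primitive f).
  by exists 1, f; rewrite scale1r oner_neq0.
move=> /existsNP[p /not_implyP[pp /contrapT[g eg]]].
have [p0 pU _] := pp.
have g0 : g != 0 by apply: contraNneq f0 => g0; rewrite eg g0 mul0r.
have elead : lead_coef f = lead_coef g * p by rewrite eg lead_coefM lead_coefC.
have [q qs [w ew]] : exists2 q, q \in s & divides p q.
  apply: prime_divides_prod => //; exists (u^-1 * lead_coef g).
  by rewrite -mulrA -elead e mulKr.
have wU : w \is a GRing.unit.
  have [v vU ev] := prime_divides_prime pp (sp q qs) (ex_intro _ w ew).
  by have -> : w = v by apply: (mulIf p0); rewrite -ew.
have [|||//||c [h [c0 eh ph]]] := IH (u * w) (rem q s) g.
- by rewrite unitrM uU.
- by move=> x /mem_rem/sp.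
- apply: (mulIf p0); rewrite -elead e (perm_big _ (perm_to_rem qs)) big_cons ew /=.
  ring.
- by rewrite size_rem //; case: (s) qs lek.
exists (p * c), h; rewrite mulf_neq0 //; split=> //.
by rewrite eg eh mulrC mul_polyC scalerA.
Qed.

(** A primitive f that divides g over the field of fractions divides g: the prime
  factors of the denominator c cannot divide f, hence divide the quotient. *)
Lemma primitive_cancel c f g : c != 0 -> primitive f -> divides f (c *: g) ->
  divides f g.
Proof.
move=> /hD[u [s [uU sp ->]]] pf; rewrite -scalerA -mul_polyC -mul_polyC => hf.
have uPU : u%:P \is a GRing.unit by rewrite rmorph_unit.
have {}hf : divides f ((\prod_(q <- [seq p%:P | p <- s]) q) * g).
  rewrite big_map -rmorph_prod /=; case: hf => h eh; exists (u%:P^-1 * h).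
  by rewrite -mulrA -eh mulKr.
apply: divides_cancel hf => // p' /mapP[p /sp pp ->]; first exact: prime_polyC.
exact: pf.
Qed.

Lemma primitive_dvdp f g : primitive f -> (f %| g)%R -> divides f g.
Proof.
move=> pf /Pdiv.Idomain.dvdpP[[c q] /= c0 e].
by apply: primitive_cancel c0 pf _; exists q.
Qed.

(** Euclid's lemma over the field of fractions, in the form of pseudo-division,
  and then the preceding descent of divisibility to D. *)
Lemma primitive_irreducible_prime f :
  irreducible_poly f -> primitive f -> prime_elt f.
Proof.
move=> irr pf; have [sf hf] := irr; split.
- by rewrite -size_poly_gt0; apply: leq_trans sf.
- by rewrite poly_unitE; case: eqP sf => // ->.
move=> g h [q e]; have fgh : f %| g * h by rewrite e dvdp_mull.
have [cop|ncop] := boolP (coprimep f g).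
  by right; apply: primitive_dvdp; rewrite // -(Gauss_dvdpr _ cop).
left; apply: primitive_dvdp => //.
rewrite -(eqp_dvdl _ (hf (gcdp f g) _ (dvdp_gcdl _ _))) ?dvdp_gcdr //.
Qed.

(** A primitive polynomial is irreducible, hence prime, or has a primitive
  divisor of smaller positive degree, and the quotient is again a polynomial
  over D of smaller degree. *)
Theorem factorial_poly : factorial_domain {poly D}.
Proof.
move=> f; have [k] := ubnP (size f); elim: k f => // k IH f0 lek f0n0.
have [c [f [c0 ef0 pf]]] := content_primitive f0n0.
move: lek f0n0; rewrite ef0 => lek f0n0 {f0 ef0}.

rewrite -mul_polyC; apply: factors_to_primesM.
  have [u [s [uU sp ->]]] := hD c0; rewrite rmorphM rmorph_prod /=.
  exists u%:P, [seq p%:P | p <- s]; rewrite big_map; split=> //.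
    exact: rmorph_unit.
  by move=> p' /mapP[p /sp pp ->]; apply: prime_polyC.
have {}lek : (size f <= k)%N by move: lek; rewrite size_scale.
have {f0n0}f0 : f != 0 by apply: contraNneq f0n0 => ->; rewrite scaler0.
have [s1|] := eqVneq (size f) 1%N.
  have /size_poly1P[a a0 ef] : size f == 1%N by rewrite s1.
  have [u [s [uU sp ea]]] := hD a0; apply: factors_to_primes_unit.
  rewrite ef; apply: rmorph_unit; rewrite ea; case: s sp ea => [|p s] sp ea.
    by rewrite big_nil mulr1.
  have pp : prime_elt p by apply: sp; rewrite mem_head.
  case: (pf _ pp); rewrite ef ea big_cons; exists (u * \prod_(q <- s) q)%:P.
  by rewrite -polyCM; congr _%:P; ring.
rewrite neq_ltn ltnS leqn0 size_poly_eq0 (negPf f0) /= => s1.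
have [irr|] := pselect (forall q : {poly D}, size q != 1%N -> q %| f -> q %= f).
  by apply: factors_to_primes_prime; apply: primitive_irreducible_prime.
move=> /existsNP[q0 /not_implyP[q0s /not_implyP[q0f q0nf]]].
have q00 : q0 != 0 by apply: contraTneq q0f => ->; rewrite dvd0p.
have [d [q [d0 eq pq]]] := content_primitive q00.
have qf : q %| f by move: q0f; rewrite eq dvdpZl.
have qs : size q != 1%N by move: q0s; rewrite eq size_scale.
have q0' : q != 0 by apply: contraTneq qf => ->; rewrite dvd0p.
have [r er] := primitive_dvdp pq qf.
have r0 : r != 0 by apply: contraNneq f0 => r0; rewrite er r0 mul0r.
have szq : (size q < size f)%N.
  rewrite ltn_neqAle dvdp_leq // andbT; apply/negP => sqf; apply: q0nf.
  by move: sqf; rewrite (dvdp_size_eqp qf) eq; apply: eqp_trans; apply: eqp_scale.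
have szq1 : (1 < size q)%N.
  by rewrite ltn_neqAle eq_sym qs size_poly_gt0.
have szr : (size r < size f)%N by rewrite er size_mul //; lia.
by rewrite er; apply: factors_to_primesM; apply: IH => //; lia.
Qed.

End PolyFactorial.

Section Transfer.

Variables (D E : idomainType) (phi : {rmorphism D -> E}) (psi : {rmorphism E -> D}).
Hypotheses (phiK : cancel phi psi) (psiK : cancel psi phi).

Lemma factorial_iso : factorial_domain E -> factorial_domain D.
Proof.
have dv a b : divides (psi a) b <-> divides a (phi b).
  split=> [[c ->]|[c e]]; first by exists (phi c); rewrite rmorphM psiK.
  by exists (psi c); rewrite -rmorphM -e phiK.
have pp p : prime_elt p -> prime_elt (psi p).
  move=> [p0 pU hp]; split.
  - by rewrite -(rmorph0 psi) (can_eq psiK).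
  - by apply: contra pU => /(rmorph_unit phi); rewrite psiK.
  - by move=> a b /dv; rewrite rmorphM => /hp[] /dv; [left|right].
move=> hE a a0; have [|u [s [uU sp e]]] := hE (phi a).
  by rewrite -(rmorph0 phi) (can_eq phiK).
exists (psi u), (map psi s); split.
- exact: rmorph_unit.
- by move=> _ /mapP[p /sp h ->]; apply: pp.
- by rewrite -(phiK a) e rmorphM rmorph_prod big_map.
Qed.

End Transfer.

(** * Polynomials in several variables *)

Section MpolyFactorial.

Variable K : fieldType.

(** The inverse of muni. *)
Definition of_muni n : {rmorphism {poly {mpoly K[n]}} -> {mpoly K[n.+1]}} :=
  horner_eval 'X_ord_max \o map_poly (@mwiden n K).

Lemma of_muniC n (c : {mpoly K[n]}) : of_muni n c%:P = mwiden c.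
Proof. by rewrite /of_muni /= map_polyC /= horner_evalE hornerC. Qed.

Lemma of_muniX n : of_muni n 'X = 'X_ord_max.
Proof. by rewrite /of_muni /= map_polyX horner_evalE hornerX. Qed.

Lemma of_muniZ n (c : {mpoly K[n]}) p : of_muni n (c *: p) = mwiden c * of_muni n p.
Proof. by rewrite -mul_polyC rmorphM of_muniC. Qed.

Lemma muniX n (m : 'X_{1..n.+1}) : muni 'X_[K, m] =
  'X_[[multinom m (widen_ord (leqnSn n) i) | i < n]] *: 'X^(m ord_max).
Proof. by rewrite muniE msuppX big_seq1 mcoeffX eqxx scale1r. Qed.

Lemma ord_max_or_widen n (i : 'I_n.+1) :
  i = ord_max \/ exists j : 'I_n, i = widen_ord (leqnSn n) j.
Proof.
case: (unliftP ord_max i) => [j|] ->; [right; exists j | by left].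
by apply: val_inj; rewrite /= /bump leqNgt ltn_ord.
Qed.

Lemma muniK n : cancel (@muni n K) (of_muni n).
Proof.
elim/mpolyind => [|c m p _ _ IH]; first by rewrite !rmorph0.
rewrite muniD rmorphD; congr (_ + _); last exact: IH.
rewrite muniZ muniX.
rewrite !of_muniZ rmorphXn of_muniX mwidenC mul_mpolyC mwidenX; congr (_ *: _).
rewrite mpolyXn -mpolyXD; congr 'X_[_].
apply/mnmP => i; rewrite mnmDE mulmnE mnm1E.
have [->|[j ->]] := ord_max_or_widen i.
  by rewrite mnmwiden_ordmax eqxx mul1n.
rewrite mnmwiden_widen mnmE -val_eqE /= gtn_eqF // mul0n addn0 //.
Qed.

Lemma muni_mwiden n (p : {mpoly K[n]}) : muni (mwiden p) = p%:P.
Proof.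
elim/mpolyind: p => [|c m p _ _ IH]; first by rewrite !rmorph0.
rewrite mwidenD muniD IH polyCD; congr (_ + _).
rewrite mwidenZ mwidenX muniZ muniX mnmwiden_ordmax expr0 -mul_polyC alg_polyC.
rewrite -polyCM mul_mpolyC; congr (_ *: 'X_[_])%:P.
by apply/mnmP => i; rewrite mnmE mnmwiden_widen.
Qed.

Lemma of_muniK n : cancel (of_muni n) (@muni n K).
Proof.
elim/poly_ind => [|p c IH]; first by rewrite !rmorph0.
rewrite rmorphD rmorphM of_muniX of_muniC muniD muniM IH muni_mwiden.
congr (_ * _ + _); rewrite muniX mnm1E eqxx expr1 -[RHS]scale1r -[in RHS]mpolyX0.
congr ('X_[_] *: _); apply/mnmP => i.
by rewrite mnmE mnm1E mnm0E -val_eqE /= gtn_eqF.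
Qed.

(** Induction on the number of variables, through the isomorphism that singles
  out the last one. *)
Theorem factorial_mpoly n : factorial_domain {mpoly K[n]}.
Proof.
elim: n => [|n IH].
  move=> f f0; apply: factors_to_primes_unit.
  have ef : f = (f@_0)%:MP.
    apply/mpolyP => m; rewrite mcoeffC; have -> : m = 0%MM by apply/mnmP => -[].
    by rewrite eqxx mulr1.
  rewrite ef; apply: rmorph_unit; rewrite unitfE; apply: contraNneq f0 => e.
  by rewrite ef e.
apply: factorial_iso (factorial_poly IH); [exact: (@muniK n) | exact: (@of_muniK n)].
Qed.

End MpolyFactorial.

(** * Weight valuations of polynomials *)

Section Weight.

Variables (K : fieldType) (N : nat) (w : 'X_{1..N} -> int).
Hypothesis wD : forall m1 m2, w (m1 + m2)%MM = w m1 + w m2.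
Implicit Types (f g : {mpoly K[N]}) (m : 'X_{1..N}) (k l : int).

(** The monomial valuation with the weights w. Its value is a relation, which
  leaves the infinite value at 0 out. *)
Definition weight_ge k f : Prop := forall m, m \in msupp f -> k <= w m.

Definition weight_order k f : Prop :=
  weight_ge k f /\ exists2 m, m \in msupp f & w m = k.

Lemma weight_ge0 k : weight_ge k 0.
Proof. by move=> m; rewrite msupp0. Qed.

Lemma weight_geD k f g : weight_ge k f -> weight_ge k g -> weight_ge k (f + g).
Proof. by move=> hf hg m /msuppD_le; rewrite mem_cat => /orP[/hf|/hg]. Qed.

Lemma weight_geM k l f g : weight_ge k f -> weight_ge l g -> weight_ge (k + l) (f * g).
Proof.
move=> hf hg m /msuppM_le /allpairsP[[m1 m2] /= [/hf h1 /hg h2 ->]].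
by rewrite wD lerD.
Qed.

Lemma weight_geX k m : k <= w m -> weight_ge k 'X_[m].
Proof. by move=> h m'; rewrite msuppX inE => /eqP->. Qed.

Lemma weight_ge_le k l f : k <= l -> weight_ge l f -> weight_ge k f.
Proof. by move=> kl h m /h; apply: le_trans. Qed.

Lemma weight_order_exists f : f != 0 -> exists k, weight_order k f.
Proof.
rewrite -msupp_eq0 /weight_order /weight_ge; elim: (msupp f) => // m s IH _.
have [->|/IH[k [ks [m' m's e]]]] := eqVneq s [::].
  by exists (w m); split=> [m'|]; [|exists m]; rewrite ?mem_head // inE => /eqP->.
have [le|lt] := leP k (w m).
  exists k; split=> [m1|]; last by exists m'; rewrite // inE m's orbT.
  by rewrite inE => /predU1P[->//|/ks].
exists (w m); split=> [m1|]; last by exists m; rewrite ?mem_head.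
by rewrite inE => /predU1P[->//|/ks]; apply: le_trans; apply: ltW.
Qed.

Lemma weight_order_uniq k l f : weight_order k f -> weight_order l f -> k = l.
Proof.
move=> [h1 [m1 s1 e1]] [h2 [m2 s2 e2]]; apply/eqP; rewrite eq_le.
by have := h1 _ s2; have := h2 _ s1; rewrite e1 e2 => -> ->.
Qed.

Lemma weight_order_ge k l f : weight_order k f -> weight_ge l f -> l <= k.
Proof. by move=> [_ [m ms <-]]; apply. Qed.

Lemma weight_orderX m : weight_order (w m) 'X_[m].
Proof.
split; first exact: weight_geX.
by exists m; rewrite // msuppX inE.
Qed.

(** The product of the parts of lowest weight does not vanish, and nothing in
  the remaining product can cancel it. *)
Lemma weight_orderM k l f g :
  weight_order k f -> weight_order l g -> weight_order (k + l) (f * g).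
Proof.
have split_low k' h : weight_order k' h -> exists h0 h1, [/\ h = h0 + h1, h0 != 0,
    forall m, m \in msupp h0 -> w m = k' & weight_ge (k' + 1) h1].
  move=> [hk [m0 m0s e0]].
  pose part Q := \sum_(m <- msupp h | Q m) h@_m *: 'X_[m] : {mpoly K[N]}.
  have partE Q m : (part Q)@_m = if Q m then h@_m else 0.
    rewrite raddf_sum big_mkcond [h in RHS]mpolyE raddf_sum /=.
    case: ifP => Qm; [apply: eq_bigr|rewrite big1 //] => m' _;
      rewrite mcoeffZ mcoeffX; case: (eqVneq m' m) => [->|_];
      by rewrite ?Qm // mulr0; case: ifP.
  have supp Q m : m \in msupp (part Q) -> m \in msupp h /\ Q m.
    by rewrite !mcoeff_msupp partE; case: ifP; rewrite ?eqxx.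
  exists (part (fun m => w m == k')), (part (fun m => w m != k')); split.
  - by rewrite {1}(mpolyE h) (bigID (fun m => w m == k')).
  - apply/eqP => /(congr1 (mcoeff m0)); rewrite partE e0 eqxx mcoeff0.
    by move/eqP; rewrite mcoeff_eq0 m0s.
  - by move=> m /supp[_ /eqP].
  - by move=> m /supp[/hk le /eqP ne]; lia.
move=> hf hg; split; first by apply: weight_geM; [case: hf|case: hg].
have [f0 [f1 [-> f0n0 hf0 hf1]]] := split_low _ _ hf.
have [g0 [g1 [-> g0n0 hg0 hg1]]] := split_low _ _ hg.
have : msupp (f0 * g0) != [::] by rewrite msupp_eq0 mulf_neq0.
case E : (msupp (f0 * g0)) => [//|m s] _.
have ms : m \in msupp (f0 * g0) by rewrite E mem_head.
have wm : w m = k + l.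
  have /msuppM_le/allpairsP[[m1 m2] /= [/hf0 h1 /hg0 h2 ->]] := ms.
  by rewrite wD h1 h2.
exists m => //.
have ge_rest : weight_ge (k + l + 1) ((f0 + f1) * g1 + f1 * g0).
  have ge0 x f' : (forall m, m \in msupp f' -> w m = x) -> weight_ge x f'.
    by move=> h m' /h->.
  apply: weight_geD.
    rewrite -addrA; apply: weight_geM => //; apply: weight_geD; first exact: ge0.
    by apply: weight_ge_le hf1; lia.
  by rewrite addrAC; apply: weight_geM => //; apply: ge0.
have -> : (f0 + f1) * (g0 + g1) = f0 * g0 + ((f0 + f1) * g1 + f1 * g0) by ring.
rewrite mcoeff_msupp mcoeffD [X in _ + X](_ : _ = 0) ?addr0 -?mcoeff_msupp //.
by apply/eqP; rewrite mcoeff_eq0; apply/negP => /ge_rest; rewrite wm; lia.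
Qed.

End Weight.

(** * Ideals with a discrete valuation *)

Section Valuation.

Variable R : idomainType.
Implicit Types (F : nat -> R -> Prop) (a b s u h : R) (I : {pred R}).

(** F k a stands for v(a) >= k, where v is a discrete valuation that is
  nonnegative on R. The last property makes the ideals of the filtration the
  contractions from the localization at the center of v: up to a factor of
  value 0, an element of value at least k is a multiple of the k-th power of
  an element of positive value. *)
Record valuation_filtration F : Prop := ValuationFiltration {
  filt0 : forall a, F 0%N a;
  filtS : forall k a, F k.+1 a -> F k a;
  filt_zero : forall k, F k 0;
  filtD : forall k a b, F k a -> F k b -> F k (a + b);
  filtM : forall k l a b, F k a -> F l b -> F (k + l)%N (a * b);
  filt_level : forall a, a != 0 -> exists k, F k a /\ ~ F k.+1 a;
  filt_strict : forall k l a b, F k a -> ~ F k.+1 a -> F l b -> ~ F l.+1 b ->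
    ~ F (k + l).+1 (a * b);
  filt_uniformizer : forall k a, F k a ->
    exists s u h, [/\ ~ F 1%N s, F 1%N u & s * a = u ^+ k * h] }.

Section Center.

Variables (F : nat -> R -> Prop) (I : {pred R}).
Hypotheses (hF : valuation_filtration F) (hI : forall a, a \in I <-> F 1%N a).

Lemma filt_le k l a : (k <= l)%N -> F l a -> F k a.
Proof.
elim: l => [|l IH]; first by rewrite leqn0 => /eqP->.
by rewrite leq_eqVlt => /predU1P[->//|/IH h /(filtS hF)].
Qed.

Lemma filt_level_leq k l a : F k a -> ~ F l.+1 a -> (k <= l)%N.
Proof. by move=> Fk nF; rewrite leqNgt; apply/negP => /filt_le/(_ Fk). Qed.

Lemma filt_one : ~ F 1%N 1.
Proof.
have [k [Fk nF]] := filt_level hF (oner_neq0 R).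
case: k Fk nF => // k Fk nF _; apply: nF.
have := filtM hF Fk Fk; rewrite mulr1; apply: filt_le; lia.
Qed.

Lemma filtMl k a b : F k b -> F k (a * b).
Proof. by move/(filtM hF (filt0 hF a)). Qed.

Lemma filt_cancel k s a : ~ F 1%N s -> F k (s * a) -> F k a.
Proof.
move=> ns Fsa; have [->|a0] := eqVneq a 0; first exact: filt_zero.
have [l [Fl nl]] := filt_level hF a0; apply: (filt_le _ Fl).
exact: filt_level_leq Fsa (filt_strict hF (filt0 hF s) ns Fl nl).
Qed.

Lemma center_prime : prime_ideal I.
Proof.
split; first split.
- by apply/hI; apply: filt_zero.
- by apply/negP => /hI /filt_one.
- by move=> a u v /hI Fu /hI Fv; apply/hI; apply: (filtD hF) => //; apply: filtMl.
move=> u v /hI Fuv; apply/orP; have [|nu] := boolP (u \in I); [by left|right].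
by apply/hI; apply: filt_cancel Fuv => /hI; apply/negP.
Qed.

(** Elements of value 0 can be cancelled, so a multiple of a by one of them lies
  in the k-th power of I only if a has value at least k; the converse is what the
  uniformizer is for. *)
Lemma center_symbolic_power k a : (a \in symbolic_power I k) <-> F k a.
Proof.
split=> [/asboolP[s sI /asboolP[r [/allP rI e]]]|Fa].
  apply: (@filt_cancel k s); first by move=> /hI; apply/negP.
  rewrite e big_seq; elim/big_ind: _ => [|x y|[x y] /rI /asboolP[f fI /= ->]].
  - exact: filt_zero.
  - exact: filtD.
  - apply: filtMl; elim: k f fI {rI} => [|k IH] f fI; first exact: filt0.
    rewrite big_ord_recl; apply: (filtM hF (k := 1%N) (l := k)); first by apply/hI.
    by apply: IH => i; apply: fI.
have [s [u [h [ns Fu e]]]] := filt_uniformizer hF Fa.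
apply/asboolP; exists s; first by apply/negP => /hI.
apply/asboolP; exists [:: (h, u ^+ k)]; rewrite big_seq1 /= andbT e mulrC; split=> //.
apply/asboolP; exists (fun=> u); first by move=> _; apply/hI.
by rewrite prodr_const card_ord.
Qed.

Lemma center_valuation_at k a : valuation_at I a k <-> F k a /\ ~ F k.+1 a.
Proof.
rewrite /valuation_at; split=> -[h1 h2]; split; try exact/center_symbolic_power.
  by move=> /center_symbolic_power; apply/negP.
by apply/negP => /center_symbolic_power.
Qed.

Lemma valuation_at_exists a : a != 0 -> exists k, valuation_at I a k.
Proof. by move=> /(filt_level hF)[k ?]; exists k; apply/center_valuation_at. Qed.

Lemma valuation_atM a b k l : valuation_at I a k -> valuation_at I b l ->
  valuation_at I (a * b) (k + l).
Proof.
move=> /center_valuation_at[Fk nk] /center_valuation_at[Fl nl].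
apply/center_valuation_at; split; [exact: (filtM hF) | exact: (filt_strict hF)].
Qed.

End Center.
End Valuation.

(** * The cone of the toric ring *)

Section Cone.

Variables (K : fieldType) (n : nat) (P : {fset 'X_{1..n}}).
Hypothesis hP : discrete_polymatroid P.
Implicit Types (m : 'X_{1..n.+1}) (v : 'X_{1..n}) (A B : {set 'I_n}).
Implicit Types (f g : {mpoly K[n.+1]}).
Local Notation AA := (closed_inseparable P).
Local Notation widen := (widen_ord (leqnSn n)).
Local Notation t := ('X_ord_max : {mpoly K[n.+1]}).
Local Notation et := (U_(ord_max : 'I_n.+1))%MM.

Definition xpart m : 'X_{1..n} := [multinom m (widen i) | i < n].

Lemma xpartD m1 m2 : xpart (m1 + m2)%MM = (xpart m1 + xpart m2)%MM.
Proof. by apply/mnmP => i; rewrite !(mnmDE, mnmE). Qed.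

Lemma xpart_mnmwiden v : xpart (mnmwiden v) = v.
Proof. by apply/mnmP => i; rewrite mnmE mnmwiden_widen. Qed.

Lemma xpart_et : xpart et = 0%MM.
Proof. by apply/mnmP => i; rewrite !mnmE -val_eqE /= gtn_eqF. Qed.

Lemma monomial_split m : m = (mnmwiden (xpart m) + et *+ m ord_max)%MM.
Proof.
apply/mnmP => i; rewrite mnmDE mulmnE mnm1E.
have [->|[j ->]] := ord_max_or_widen i; first by rewrite mnmwiden_ordmax eqxx mul1n.
by rewrite mnmwiden_widen mnmE -[_ == widen j]val_eqE /= gtn_eqF // mul0n addn0.
Qed.

(** The linear form f_A of the facet of A, on the exponents of K[x, t]. *)
Definition facet A m : int := (rho P A * m ord_max)%:Z - (vsum (xpart m) A)%:Z.

Lemma facetD A m1 m2 : facet A (m1 + m2)%MM = facet A m1 + facet A m2.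
Proof. rewrite /facet xpartD vsumD mnmDE; lia. Qed.

Lemma facet0 A : facet A 0%MM = 0.
Proof. by have := facetD A 0%MM 0%MM; rewrite addm0; lia. Qed.

Lemma facet_mulmn A m k : facet A (m *+ k)%MM = facet A m * k%:Z.
Proof.
elim: k => [|k IH]; first by rewrite mulm0n facet0 mulr0.
by rewrite mulmS facetD IH; lia.
Qed.

Lemma facet_et A : facet A et = (rho P A)%:Z.
Proof. by rewrite /facet mnm1E eqxx xpart_et vsum0; lia. Qed.

Lemma facet_widen A v b :
  facet A (mnmwiden v + et *+ b)%MM = (b * rho P A)%:Z - (vsum v A)%:Z.
Proof.
rewrite facetD facet_mulmn facet_et /facet mnmwiden_ordmax xpart_mnmwiden; lia.
Qed.

Lemma facet_var A i : facet A U_(widen i)%MM = - (i \in A)%:Z.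
Proof.
have -> : U_(widen i)%MM = mnmwiden U_(i)%MM by rewrite mnmwiden1.
by rewrite /facet mnmwiden_ordmax xpart_mnmwiden vsumU1; lia.
Qed.

Definition in_cone m : Prop := forall A, A \in AA -> 0 <= facet A m.

Lemma in_coneD m1 m2 : in_cone m1 -> in_cone m2 -> in_cone (m1 + m2)%MM.
Proof. by move=> h1 h2 A AAA; rewrite facetD addr_ge0 ?h1 ?h2. Qed.

Lemma toric_monomialE v : toric_monomial K v = 'X_[mnmwiden v + et].
Proof.
rewrite /toric_monomial mpolyXD; congr (_ * _); rewrite mpolyXE_id big_ord_recr /=.
rewrite mnmwiden_ordmax expr0 mulr1; apply: eq_bigr => i _.
by rewrite mnmwiden_widen.
Qed.

Lemma toric_monomial_cone v : v \in P -> in_cone (mnmwiden v + et)%MM.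
Proof.
move=> vP A _; have := facet_widen A v 1; rewrite mulm1n => ->.
by have := vsum_le_rho A vP; lia.
Qed.

Lemma cone_monomial m : in_cone m -> exists s : seq 'X_{1..n},
  {in s, forall v, v \in P} /\ m = (\sum_(v <- s) (mnmwiden v + et))%MM.
Proof.
move=> hm; have [|s [ss sP es]] :=
  polymatroid_decomposition hP (a := xpart m) (b := m ord_max).
  apply: closed_inseparable_suffices => // A /hm; rewrite /facet; lia.
exists s; split=> //; rewrite {1}(monomial_split m) -ss es.
elim: (s) => [|v s' IH]; first by rewrite !big_nil mulm0n mnmwiden0 addm0.
rewrite !big_cons mnmwidenD mulmS -IH.
by apply/mnmP => i; rewrite !mnmDE addnACA.
Qed.

(** The toric ring is the semigroup ring of the lattice points of its cone, so it
  is recognized by the facets alone. *)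
Lemma in_toric_ringP f :
  f \in in_toric_ring P <-> forall m, m \in msupp f -> in_cone m.
Proof.
split=> [/asboolP h|h].
  suff /asboolP : f \in (fun g => `[< forall m, m \in msupp g -> in_cone m >]) by [].
  apply: h => [|v vP].
    split.
    - apply/asboolP => m; rewrite msupp1 inE => /eqP-> A _.
      by rewrite facet0.
    - move=> c x y /asboolP hx /asboolP hy; apply/asboolP => m /msuppD_le.
      by rewrite mem_cat => /orP[/msuppZ_le/hx|/hy].
    - move=> x y /asboolP hx /asboolP hy; apply/asboolP.
      move=> m /msuppM_le /allpairsP[[m1 m2] /= [/hx h1 /hy h2 ->]].
      exact: in_coneD.
  apply/asboolP => m; rewrite toric_monomialE msuppX inE => /eqP->.
  exact: toric_monomial_cone.
apply/asboolP => S hS gS; have [S1 SL SM] := hS.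
have S0 : 0 \in S by have := SL (-1) 1 1 S1 S1; rewrite scaleN1r addNr.
rewrite (mpolyE f) big_seq; elim/big_ind: _ => // [x y xS yS|m /h hm].
  by rewrite -[x]scale1r SL.
rewrite -[_ *: _]addr0 SL //; have [s [sP ->]] := cone_monomial hm.
rewrite big_seq; elim/big_ind: _ => [|x y|v vs]; first by rewrite mpolyX0.
  by rewrite mpolyXD; apply: SM.
by rewrite -toric_monomialE; apply/gS/sP.
Qed.

(** Multiples of an interior point of the facet of A have value 0 at A and large
  values elsewhere, and a variable that belongs to A has value - 1 at A: adding
  or removing copies of it gives both signs of l. *)
Lemma facet_shift A (l : int) (N : nat) : A \in AA -> exists m,
  facet A m = l /\ forall B, B \in AA -> B != A -> N%:Z <= facet B m.
Proof.
move=> AAA; have [q [b [qA qB [i iA qi]]]] := facet_interior hP AAA.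
pose m0 := (mnmwiden q + et *+ b)%MM.
have m0A : facet A m0 = 0 by rewrite facet_widen qA; lia.
have m0B B : B \in AA -> B != A -> 1 <= facet B m0.
  by move=> BAA BA; rewrite facet_widen; have := qB B BAA BA; lia.
(* q vanishes at A only, and stepping along a variable of A changes the value
  there by one; the step back is possible because q contains that variable *)
pose k := absz l; have [le|ge] := leP l 0.
  exists (m0 *+ (N + k) + U_(widen i) *+ k)%MM; split.
    by rewrite facetD !facet_mulmn m0A facet_var iA /k; lia.
  move=> B BAA BA; rewrite facetD !facet_mulmn facet_var.
  by have := m0B B BAA BA; case: (i \in B); nia.
exists (m0 *+ (N + k) - U_(widen i) *+ k)%MM.
have sub : (U_(widen i) *+ k <= m0 *+ (N + k))%MM.
  apply/mnm_lepP => j; rewrite !mulmnE mnm1E; case: eqP => [<-|_] //.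
  by rewrite mnmDE mnmwiden_widen; nia.
have E B : facet B (m0 *+ (N + k) - U_(widen i) *+ k)%MM =
    facet B m0 * (N + k)%:Z + (i \in B)%:Z * k%:Z.
  have := facetD B (m0 *+ (N + k) - U_(widen i) *+ k)%MM (U_(widen i) *+ k)%MM.
  by rewrite submK // !facet_mulmn facet_var; lia.
split; first by rewrite E m0A iA /k; lia.
by move=> B BAA BA; rewrite E; have := m0B B BAA BA; case: (i \in B); nia.
Qed.

Lemma facet_ge_msize A f m : m \in msupp f -> - (msize f)%:Z <= facet A m.
Proof.
move=> ms; have : (vsum (xpart m) A <= msize f)%N.
  apply: leq_trans (ltnW (msize_mdeg_lt ms)).
  apply: leq_trans (vsum_subset _ (subsetT A)) _; rewrite vsum_setT !mdegE.
  rewrite [leqRHS]big_ord_recr /=; apply: leq_trans (leq_addr _ _).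
  by apply: leq_sum => i _; rewrite mnmE.
rewrite /facet; lia.
Qed.

(** The forms of the facets are positive at t. So the localization of the toric
  ring at t is that of K[x, t]. *)
Lemma in_toric_ring_t f : exists N, f * t ^+ N \in in_toric_ring P.
Proof.
exists (msize f); apply/in_toric_ringP; rewrite mpolyXn => m.
rewrite (perm_mem (msuppMX _ _)) => /mapP[m' /facet_ge_msize ms ->] A AAA.
have [A0 _] := rho_closedP AAA; have := rho_gt0 hP A0.
by rewrite facetD facet_mulmn facet_et; have := ms A; nia.
Qed.

End Cone.

(** * The monomial primes *)

Section ToricPrimes.

Variables (K : fieldType) (n : nat) (P : {fset 'X_{1..n}}).
Hypothesis hP : discrete_polymatroid P.
Implicit Types (m : 'X_{1..n.+1}) (v : 'X_{1..n}) (A B : {set 'I_n}).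
Implicit Types (f g h : {mpoly K[n.+1]}).
Local Notation AA := (closed_inseparable P).
Local Notation t := ('X_ord_max : {mpoly K[n.+1]}).
Local Notation et := (U_(ord_max : 'I_n.+1))%MM.
Local Notation R := (toric_ring K P).
Implicit Types (a b s u : R) (I J : {pred R}).

Definition to_toric f : R := insubd (0 : R) f.

Lemma val_eq0 a : (toric_val a == 0) = (a == 0).
Proof. exact: (inj_eq val_inj a 0). Qed.

Lemma toric_val_inj : injective (@toric_val K n P).
Proof. exact: val_inj. Qed.

Lemma toric_val0 : toric_val (0 : R) = 0.
Proof. exact: (rmorph0 (val : R -> _)). Qed.

Lemma toric_valD a b : toric_val (a + b) = toric_val a + toric_val b.
Proof. exact: (rmorphD (val : R -> _)). Qed.

Lemma toric_valM a b : toric_val (a * b) = toric_val a * toric_val b.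
Proof. exact: (rmorphM (val : R -> _)). Qed.

Lemma toric_valXn a k : toric_val (a ^+ k) = toric_val a ^+ k.
Proof. exact: (rmorphXn (val : R -> _)). Qed.

Lemma toric_val_sum (I : Type) (r : seq I) (F : I -> R) :
  toric_val (\sum_(i <- r) F i) = \sum_(i <- r) toric_val (F i).
Proof. exact: (rmorph_sum (val : R -> _)). Qed.

Lemma to_toricK f : f \in in_toric_ring P -> toric_val (to_toric f) = f.
Proof. exact: insubdK. Qed.

Lemma toric_cone a m : m \in msupp (toric_val a) -> in_cone P m.
Proof. by move/(in_toric_ringP hP): (valP a); apply. Qed.

Lemma toric_ringX m : in_cone P m -> 'X_[m] \in in_toric_ring (K := K) P.
Proof. by move=> hm; apply/in_toric_ringP => // m'; rewrite msuppX inE => /eqP->. Qed.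

Lemma et_cone : in_cone P et.
Proof. by move=> A _; rewrite facet_et. Qed.

Definition tR : R := to_toric t.

Lemma val_tR : toric_val tR = t.
Proof. by rewrite to_toricK //; apply/toric_ringX/et_cone. Qed.

Lemma tR_neq0 : tR != 0.
Proof. by rewrite -val_eq0 val_tR -msupp_eq0 msuppX. Qed.

Definition facet_filt A (k : nat) a : Prop := weight_ge (facet P A) k%:Z (toric_val a).

Lemma facet_order A a : A \in AA -> a != 0 ->
  exists k : nat, weight_order (facet P A) k%:Z (toric_val a).
Proof.
rewrite -val_eq0 => AAA /(weight_order_exists (facet P A))[k [hk [m ms e]]].
have : 0 <= facet P A m by apply: (toric_cone ms).
by rewrite e; case: k hk e => // k hk e _; exists k; split=> //; exists m.
Qed.

Lemma facet_levelP A k a : weight_order (facet P A) k%:Z (toric_val a) <->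
  facet_filt A k a /\ ~ facet_filt A k.+1 a.
Proof.
split=> [h|[hk nk]].
  by split=> [|/(weight_order_ge h)]; [case: h|lia].
split=> //; apply: contrapT => nex; apply: nk => m ms.
have := hk m ms; rewrite le_eqVlt => /predU1P[e|]; last by lia.
by case: nex; exists m.
Qed.

(** Uniformizers exist because facet_shift supplies a monomial of value 1 at A in
  the cone, and a monomial of value - k at A that is nonnegative elsewhere. *)
Lemma facet_filtration A : A \in AA -> valuation_filtration (facet_filt A).
Proof.
move=> AAA; split.
- by move=> a m /toric_cone; apply.
- by move=> k a; apply: weight_ge_le; lia.
- by move=> k; rewrite /facet_filt toric_val0; apply: weight_ge0.
- by move=> k a b ha hb; rewrite /facet_filt toric_valD; apply: weight_geD.
- move=> k l a b ha hb; rewrite /facet_filt toric_valM PoszD.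
  by apply: weight_geM => //; apply: facetD.
- move=> a /(facet_order AAA)[k h]; exists k; exact/facet_levelP.
- move=> k l a b ka na lb nb; have /facet_levelP[] // :
    weight_order (facet P A) (k + l)%:Z (toric_val (a * b)).
  rewrite toric_valM PoszD; apply: weight_orderM; first exact: facetD.
    exact/facet_levelP.
  exact/facet_levelP.
- move=> k a ha; have [m1 [m1A m1B]] := facet_shift hP 1 0 AAA.
  have [z [zA zB]] := facet_shift hP (- k%:Z) 0 AAA.
  have m1c : in_cone P m1.
    by move=> B BAA; have [->|/m1B] := eqVneq B A; [rewrite m1A | apply].
  have skc : in_cone P (m1 *+ k + z)%MM.
    move=> B BAA; rewrite facetD facet_mulmn.
    have [->|BA] := eqVneq B A; first by rewrite m1A zA; lia.
    by have := m1B B BAA BA; have := zB B BAA BA; nia.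
  have hc : 'X_[z] * toric_val a \in in_toric_ring P.
    apply/in_toric_ringP => // m /msuppM_le/allpairsP[[m' m2] /=].
    rewrite msuppX inE => -[/eqP-> m2a ->] B BAA; rewrite facetD.
    have [->|BA] := eqVneq B A; first by rewrite zA; have := ha _ m2a; lia.
    by have := zB B BAA BA; have := toric_cone m2a BAA; lia.
  exists (to_toric 'X_[m1 *+ k + z]), (to_toric 'X_[m1]),
    (to_toric ('X_[z] * toric_val a)).
  split.
  + rewrite /facet_filt to_toricK ?toric_ringX // => /(_ (m1 *+ k + z)%MM).
    by rewrite msuppX mem_head facetD facet_mulmn m1A zA => /(_ isT); lia.
  + rewrite /facet_filt to_toricK ?toric_ringX //; apply: weight_geX.
    by rewrite m1A.
  + apply: toric_val_inj; rewrite !toric_valM toric_valXn !to_toricK ?toric_ringX //.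
    by rewrite mpolyXD mpolyXn mulrA.
Qed.

(** A monomial of the cone is a product of generators, and if it is positive on
  the facet form of A then so is one of its factors, a generator of the ideal. *)
Lemma monomial_primeP A a : A \in AA ->
  (a \in monomial_prime K P A) <-> facet_filt A 1 a.
Proof.
move=> AAA; have hF := facet_filtration AAA; split.
  case/asboolP => s [/allP sP ->]; rewrite big_seq.
  elim/big_ind: _ => [|x y|[x y] /sP /asboolP[v [vP lt e]] /=].
  - exact: (filt_zero hF).
  - exact: (filtD hF).
  - apply: (filtMl hF); rewrite /facet_filt e toric_monomialE; apply: weight_geX.
    by have := facet_widen P A v 1; rewrite mulm1n => ->; lia.
pose G : {pred R} := fun x : R => `[< exists v : 'X_{1..n},
  [/\ v \in P, (vsum v A < rho P A)%N & toric_val x = toric_monomial K v] >].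
have span0 : 0 \in ideal_span G by apply/asboolP; exists [::]; rewrite big_nil.
have spanD x y : x \in ideal_span G -> y \in ideal_span G -> x + y \in ideal_span G.
  move=> /asboolP[s1 [h1 ->]] /asboolP[s2 [h2 ->]]; apply/asboolP.
  by exists (s1 ++ s2); rewrite all_cat h1 h2 big_cat.
have spanX c m : in_cone P m -> 1 <= facet P A m ->
    forall x : R, toric_val x = c *: 'X_[m] -> x \in ideal_span G.
  move=> hm fm x ex; have [s [sP em]] := cone_monomial hP hm.
  have [v vs lt] : exists2 v, v \in s & (vsum v A < rho P A)%N.
    apply: contrapT => nex; move: fm; suff -> : facet P A m = 0 by [].
    rewrite em big_seq; elim/big_ind: _ => [|x1 y1|v vs]; first exact: facet0.
      by rewrite facetD => -> ->.
    have := facet_widen P A v 1; rewrite mulm1n => ->.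
    have := vsum_le_rho A (sP v vs); have [lt|] := ltnP (vsum v A) (rho P A).
      by case: nex; exists v.
    lia.
  pose m' := (\sum_(v <- rem v s) (mnmwiden v + et))%MM.
  have em' : m = (m' + (mnmwiden v + et))%MM.
    rewrite em (perm_big _ (perm_to_rem vs)) big_cons /=.
    by rewrite addmC.
  have m'c : c *: 'X_[m'] \in in_toric_ring P.
    apply/in_toric_ringP => // m2 /msuppZ_le; rewrite msuppX inE => /eqP->.
    rewrite /m' big_seq; elim/big_ind: _ => [B _|x1 y1|w /mem_rem/sP wP].
    - by rewrite facet0.
    - exact: in_coneD.
    - exact: toric_monomial_cone.
  have vc := toric_ringX (toric_monomial_cone (sP v vs)).
  apply/asboolP; exists [:: (to_toric (c *: 'X_[m']), to_toric 'X_[mnmwiden v + et])].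
  rewrite big_seq1 /= andbT; split.
    apply/asboolP; exists v; split; [exact: sP|by []|].
    by rewrite to_toricK // toric_monomialE.
  apply: toric_val_inj; rewrite ex toric_valM !to_toricK // -scalerAl -mpolyXD.
  by rewrite -em'.
move=> ha; have termc m : m \in msupp (toric_val a) ->
    (toric_val a)@_m *: 'X_[m] \in in_toric_ring P.
  move=> ms; apply/in_toric_ringP => // m' /msuppZ_le; rewrite msuppX inE => /eqP->.
  exact: toric_cone ms.
have -> : a = \sum_(m <- msupp (toric_val a)) to_toric ((toric_val a)@_m *: 'X_[m]).
  apply: toric_val_inj; rewrite [LHS]mpolyE toric_val_sum.
  by apply: eq_big_seq => m /termc h; rewrite to_toricK.
rewrite big_seq; elim/big_ind: _ => // m ms.
apply: (spanX ((toric_val a)@_m) m); [exact: toric_cone ms | exact: ha |].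
by rewrite to_toricK ?termc.
Qed.

End ToricPrimes.

(** * Height one primes of the toric ring *)

Lemma prime_pow_cancel (D : idomainType) (p a b : D) k :
  prime_elt p -> ~ divides p a -> divides (p ^+ k) (a * b) -> divides (p ^+ k) b.
Proof.
move=> pp na; have [p0 _ hp] := pp; elim: k b => [|k IH] b.
  by move=> _; exists b; rewrite expr0 mulr1.
rewrite exprS => -[c e].
have [//|[d ed]] : divides p a \/ divides p b.
  by apply: hp; exists (c * p ^+ k); rewrite e; ring.
have [|c' ec'] := IH d; last by exists c'; rewrite ed ec'; ring.
by exists c; apply: (mulIf p0); rewrite -mulrA -ed e; ring.
Qed.

Lemma mpoly_unit_msize (K : fieldType) N (g : {mpoly K[N]}) :
  g != 0 -> g \isn't a GRing.unit -> (1 < msize g)%N.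
Proof.
move=> g0 gU; rewrite ltnNge; apply/negP => le; move/negP: gU; apply.
have e := msize1_polyC le; rewrite e; apply: rmorph_unit; rewrite unitfE.
by apply: contraNneq g0 => c0; rewrite e c0.
Qed.

Lemma mpoly_prime_pow_msize (K : fieldType) N (g f : {mpoly K[N]}) k :
  prime_elt g -> f != 0 -> divides (g ^+ k) f -> (k < msize f)%N.
Proof.
move=> [g0 gU _]; elim: k f => [|k IH] f f0.
  by rewrite lt0n msize_poly_eq0.
move=> [h e]; have h0 : h != 0 by apply: contraNneq f0 => h0; rewrite e h0 mul0r.
have e' : f = (h * g ^+ k) * g by rewrite e exprSr mulrA.
have hk0 : h * g ^+ k != 0 by rewrite mulf_neq0 ?expf_neq0.
have := IH (h * g ^+ k) hk0 (ex_intro _ h erefl).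
rewrite e' (msizeM hk0 g0); have := mpoly_unit_msize g0 gU.
move: (msize g) (msize (h * g ^+ k)) => x y; lia.
Qed.

Lemma mpoly_var_irreducible (K : fieldType) N (i : 'I_N) (g : {mpoly K[N]}) :
  g \isn't a GRing.unit -> divides g 'X_i ->
  exists2 u, u \is a GRing.unit & 'X_i = u * g.
Proof.
move=> gU [u e]; exists u => //; have X0 : ('X_i : {mpoly K[N]}) != 0.
  by rewrite -msupp_eq0 msuppX.
move: (X0); rewrite e mulf_eq0 negb_or => /andP[u0 g0].
apply/contraT => uU; have := congr1 (fun p => msize p) e.
rewrite (msizeM u0 g0) msizeX mdeg1.
have := mpoly_unit_msize u0 uU; have := mpoly_unit_msize g0 gU.
by move: (msize g) (msize u) => x y; lia.
Qed.

Lemma mpoly_div_monomial (K : fieldType) N (f : {mpoly K[N]}) e :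
    (forall m, m \in msupp f -> (e <= m)%MM) ->
  exists2 h, f = h * 'X_[e] & forall m, m \in msupp h -> (e + m)%MM \in msupp f.
Proof.
move=> he; pose h := \sum_(m <- msupp f) f@_m *: 'X_[(m - e)%MM] : {mpoly K[N]}.
have fh : f = h * 'X_[e].
  rewrite {1}(mpolyE f) mulr_suml; apply: eq_big_seq => m /he em.
  by rewrite -scalerAl -mpolyXD submK.
exists h => // m ms; rewrite [in msupp f]fh (perm_mem (msuppMX _ _)).
by apply/mapP; exists m.
Qed.

Section ToricHeightOne.

Variables (K : fieldType) (n : nat) (P : {fset 'X_{1..n}}).
Hypothesis hP : discrete_polymatroid P.
Implicit Types (m : 'X_{1..n.+1}) (v : 'X_{1..n}) (A B : {set 'I_n}).
Implicit Types (f g h : {mpoly K[n.+1]}).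
Local Notation AA := (closed_inseparable P).
Local Notation t := ('X_ord_max : {mpoly K[n.+1]}).
Local Notation et := (U_(ord_max : 'I_n.+1))%MM.
Local Notation R := (toric_ring K P).
Implicit Types (a b s u : R) (I J : {pred R}).
Local Notation tR := (tR K P).
Local Notation to_toric := (@to_toric K n P).

(** The contraction to the toric ring of the principal ideal of K[x, t]
  generated by g. *)
Definition trace g : {pred R} := fun a => `[< divides g (toric_val a) >].

Definition mult_filt g (k : nat) a : Prop := divides (g ^+ k) (toric_val a).

Lemma to_toric_t f : exists N, toric_val (to_toric (f * t ^+ N)) = f * t ^+ N.
Proof. by have [N h] := in_toric_ring_t hP f; exists N; rewrite to_toricK. Qed.

(** The primes of K[x, t] that survive in its localization at t, which is also
  that of the toric ring. *)
Definition off_t g : Prop := prime_elt g /\ ~ divides g t.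

Lemma off_t_pow g k : off_t g -> ~ divides g (t ^+ k).
Proof.
move=> [[_ gU hg] gt]; elim: k => [|k IH].
  by rewrite expr0 => /(divides_unit (unitr1 _)); apply/negP.
by rewrite exprS => /hg[].
Qed.

Lemma mult_filtration g : off_t g -> valuation_filtration (mult_filt g).
Proof.
move=> og; have [pg gt] := og; have [g0 gU hg] := pg.
have notg k f h : divides (g ^+ k) f -> ~ divides (g ^+ k.+1) f ->
    exists2 f', f = f' * g ^+ k & ~ divides g f'.
  move=> [f' e] nf; exists f' => // -[c ec]; apply: nf.
  by exists c; rewrite e ec exprS mulrA.
split.
- by move=> a; exists (toric_val a); rewrite expr0 mulr1.
- move=> k a; apply: divides_trans; rewrite exprS.
  exact: divides_mull (dividesxx _).
- by move=> k; rewrite /mult_filt toric_val0; apply: divides0.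
- by move=> k a b ha hb; rewrite /mult_filt toric_valD; apply: dividesD.
- move=> k l a b [c ec] [d ed]; exists (c * d).
  by rewrite toric_valM ec ed exprD; ring.
- move=> a; rewrite -val_eq0 => a0.
  have ex : exists k, `[< mult_filt g k a >].
    by exists 0%N; apply/asboolP; exists (toric_val a); rewrite expr0 mulr1.
  have bd k : `[< mult_filt g k a >] -> (k <= msize (toric_val a))%N.
    by move/asboolP/(mpoly_prime_pow_msize pg a0)/ltnW.
  case: (ex_maxnP ex bd) => k /asboolP hk max; exists k; split=> // hk1.
  by have := max k.+1; rewrite ltnn; move/(_ (asboolT hk1)).
- move=> k l a b /notg h1 /(h1 0)[a' ea na] /notg h2 /(h2 0)[b' eb nb].
  rewrite /mult_filt toric_valM ea eb => -[c].
  have -> : a' * g ^+ k * (b' * g ^+ l) = (a' * b') * g ^+ (k + l) by rewrite exprD; ring.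
  rewrite exprS mulrA => /(mulIf (expf_neq0 _ g0)) e.
  by have [] : divides g a' \/ divides g b' by apply: hg; exists c.
- move=> k a [h e]; have [N eN] := to_toric_t g; have [M eM] := to_toric_t h.
  exists (tR ^+ (N * k + M)), (to_toric (g * t ^+ N)), (to_toric (h * t ^+ M)).
  split.
  + by rewrite /mult_filt toric_valXn val_tR // expr1; apply: off_t_pow.
  + by rewrite /mult_filt eN expr1; exists (t ^+ N); rewrite mulrC.
  + apply: toric_val_inj; rewrite !toric_valM !toric_valXn eN eM val_tR // e.
    by rewrite exprMn exprD exprM; ring.
Qed.

Lemma traceP g a : a \in trace g <-> mult_filt g 1 a.
Proof. by rewrite /mult_filt expr1; split=> [/asboolP|h] //; apply/asboolP. Qed.

Lemma trace_prime g : off_t g -> prime_ideal (trace g).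
Proof. by move=> /mult_filtration h; apply: (center_prime h) (traceP g). Qed.

Lemma monomial_prime_prime A : A \in AA -> prime_ideal (monomial_prime K P A).
Proof.
move=> AAA; have h := facet_filtration K hP AAA.
exact: (center_prime h (fun a => monomial_primeP hP a AAA)).
Qed.

Lemma prime_idealM I a b : prime_ideal I -> a * b \in I -> a \in I \/ b \in I.
Proof. by move=> [_ h] /h /orP. Qed.

Lemma prime_ideal_mull I a b : prime_ideal I -> b \in I -> a * b \in I.
Proof. by move=> [[I0 _ h] _] bI; rewrite -[_ * _]addr0; apply: h. Qed.

Lemma prime_idealXn I a k : prime_ideal I -> a ^+ k \in I -> a \in I.
Proof.
move=> hI; elim: k => [|k IH].
  by have [[_ /negP I1 _] _] := hI; rewrite expr0.
by rewrite exprS => /(prime_idealM hI)[].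
Qed.

(** Some prime factor g in K[x, t] of an element of I lies in I up to a power of t,
  and then so do the multiples of g. *)
Lemma prime_off_t I : prime_ideal I -> nonzero_ideal I -> tR \notin I ->
  exists2 g, off_t g & {subset trace g <= I}.
Proof.
move=> hI [a aI a0] tI.
have tnI k : tR ^+ k \notin I by apply: contra tI; apply: prime_idealXn.
have va0 : toric_val a != 0 by rewrite val_eq0.
have [u [s [uU sp ea]]] := factorial_mpoly va0.
have [g [M [pg eg gI]]] : exists g M, [/\ prime_elt g,
    toric_val (to_toric (g * t ^+ M)) = g * t ^+ M & to_toric (g * t ^+ M) \in I].
  have [N eN] : exists N, toric_val a = u * \prod_(p <- s) p * t ^+ N.
    by exists 0%N; rewrite expr0 mulr1.
  elim: s sp a N aI eN {a0 va0 ea} => [|g s IH] sp a N aI.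
    rewrite big_nil mulr1 => ea; have [M eM] := to_toric_t u^-1.
    case/negP: (tnI (N + M)%N).
    have -> : tR ^+ (N + M) = to_toric (u^-1 * t ^+ M) * a.
      apply: toric_val_inj; rewrite toric_valM toric_valXn eM ea val_tR //.
      by rewrite mulrACA mulVr // mul1r addnC exprD.
    exact: prime_ideal_mull.
  rewrite big_cons => ea; have [M1 e1] := to_toric_t g.
  have [M2 e2] := to_toric_t (u * \prod_(p <- s) p).
  have : tR ^+ N * (to_toric (g * t ^+ M1) *
      to_toric (u * \prod_(p <- s) p * t ^+ M2)) \in I.
    rewrite (_ : _ * _ = tR ^+ (M1 + M2) * a); first exact: prime_ideal_mull.
    apply: toric_val_inj; rewrite !toric_valM !toric_valXn e1 e2 ea val_tR //.
    by rewrite exprD; ring.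
  case/(prime_idealM hI) => [h|/(prime_idealM hI)[h|h]].
  - by case/negP: (tnI N).
  - by exists g, M1; split=> //; apply: sp; rewrite mem_head.
  - by apply: IH h e2 => p ps; apply: sp; rewrite inE ps orbT.
exists g; first split=> // -[c ec].
  have [M' eM'] := to_toric_t c; case/negP: (tnI (M' + M).+1).
  have -> : tR ^+ (M' + M).+1 = to_toric (c * t ^+ M') * to_toric (g * t ^+ M).
    apply: toric_val_inj; rewrite toric_valM toric_valXn eM' eg val_tR //.
    by rewrite mulrACA -ec -exprD -exprS.
  exact: prime_ideal_mull.
move=> b /asboolP[c ec]; have [M' eM'] := to_toric_t c.
have : tR ^+ (M' + M) * b \in I.
  have -> : tR ^+ (M' + M) * b = to_toric (c * t ^+ M') * to_toric (g * t ^+ M).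
    apply: toric_val_inj; rewrite !toric_valM toric_valXn eM' eg ec val_tR //.
    by rewrite exprD; ring.
  exact: prime_ideal_mull.
by case/(prime_idealM hI) => // h; case/negP: (tnI (M' + M)%N).
Qed.

(** Multiplying g by a suitable monomial brings its order at A to 0 and keeps it
  nonnegative on the other facets. *)
Lemma trace_notin_facet A g : A \in AA -> g != 0 ->
  exists2 a, a \in trace g & a \notin monomial_prime K P A.
Proof.
move=> AAA /(weight_order_exists (facet P A))[l hl].
have [w [wA wB]] := facet_shift hP (- l) (msize g) AAA.
have gw : g * 'X_[w] \in in_toric_ring P.
  apply/in_toric_ringP => // m; rewrite (perm_mem (msuppMX _ _)).
  move=> /mapP[m' ms ->] B BAA; rewrite facetD.
  have [->|/(wB B BAA)] := eqVneq B A; last by have := facet_ge_msize P B ms; lia.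
  by rewrite wA; have [/(_ _ ms) + _] := hl; lia.
exists (to_toric (g * 'X_[w])).
  by apply/asboolP; rewrite to_toricK //; exists 'X_[w]; rewrite mulrC.
apply/negP => /(monomial_primeP hP _ AAA); rewrite /facet_filt to_toricK //.
have := weight_orderM (@facetD n P A) hl (weight_orderX K (facet P A) w).
by rewrite wA addrN => /weight_order_ge h /h.
Qed.

Lemma trace_sub g g' : off_t g -> off_t g' -> {subset trace g <= trace g'} ->
  exists2 u, u \is a GRing.unit & g = u * g'.
Proof.
move=> og og'; have [M eM] := to_toric_t g => /(_ (to_toric (g * t ^+ M))).
have /[swap] /[apply] : to_toric (g * t ^+ M) \in trace g.
  by apply/asboolP; rewrite eM; exists (t ^+ M); rewrite mulrC.
have [[pg _] [pg' _]] := (og, og'); have [_ _ hg'] := pg'.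
move/asboolP; rewrite eM => /hg'[|/off_t_pow//].
exact: prime_divides_prime.
Qed.

Lemma trace_unit (u g : {mpoly K[n.+1]}) : u \is a GRing.unit -> trace (u * g) =i trace g.
Proof.
move=> uU a; apply/asboolP/asboolP => -[c ->].
  by exists (c * u); rewrite mulrA.
by exists (c * u^-1); rewrite mulrA mulrVK.
Qed.

Lemma facet_sub A B : A \in AA -> B \in AA ->
  {subset monomial_prime K P A <= monomial_prime K P B} -> A = B.
Proof.
move=> AAA BAA sub; apply/eqP; apply: contraT => neq.
have [m [mB mA]] := facet_shift hP 0 1 BAA.
have mc : in_cone P m.
  by move=> C CAA; have [->|/(mA C CAA)] := eqVneq C B; [rewrite mB|lia].
have /sub : to_toric 'X_[m] \in monomial_prime K P A.
  apply/(monomial_primeP hP _ AAA); rewrite /facet_filt to_toricK ?toric_ringX //.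
  by apply: weight_geX; apply: mA.
move/(monomial_primeP hP _ BAA); rewrite /facet_filt to_toricK ?toric_ringX //.
by move/(_ m); rewrite msuppX mem_head mB => /(_ isT).
Qed.

Lemma tR_notin_trace g : off_t g -> tR \notin trace g.
Proof. by move=> [_ gt]; apply/asboolP; rewrite val_tR. Qed.

Lemma tR_in_monomial_prime A : A \in AA -> tR \in monomial_prime K P A.
Proof.
move=> AAA; apply/(monomial_primeP hP _ AAA); rewrite /facet_filt val_tR //.
apply: weight_geX; rewrite facet_et; have [A0 _] := rho_closedP AAA.
by have := rho_gt0 hP A0.
Qed.

Lemma trace_height_one g : off_t g -> height_one_prime (trace g).
Proof.
move=> og; split; first exact: trace_prime.
  have [M eM] := to_toric_t g; exists (to_toric (g * t ^+ M)).
    by apply/asboolP; rewrite eM; exists (t ^+ M); rewrite mulrC.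
  rewrite -val_eq0 eM mulf_neq0 ?expf_neq0 //; first by case: og => -[].
  by rewrite -msupp_eq0 msuppX.
move=> J hJ nJ Jg; have tJ : tR \notin J.
  by apply/negP => /Jg; apply/negP/tR_notin_trace.
have [g' og' g'J] := prime_off_t hJ nJ tJ.
have [|u uU e] := trace_sub og' og; first by move=> a /g'J/Jg.
move=> a; apply/idP/idP => [/Jg//|ag]; apply: g'J.
by rewrite e trace_unit.
Qed.

Hypothesis hn : (0 < n)%N.

(** If I contained none of the monomial primes, then it would miss an element
  of each of them and hence the product u of these elements; but a high power
  of u, having positive order at all the facets, is divisible by t. *)
Lemma prime_over_t I : prime_ideal I -> tR \in I ->
  exists2 A, A \in AA & {subset monomial_prime K P A <= I}.
Proof.
move=> hI tI; apply: contrapT => nex.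
have [|F hF] := @fin_all_exists {set 'I_n} (fun=> R)
    (fun A a => A \in AA -> a \in monomial_prime K P A /\ a \notin I).
  move=> A; have [AAA|nA] := boolP (A \in AA); last by exists 0.
  have : ~ {subset monomial_prime K P A <= I} by move=> h; apply: nex; exists A.
  by move=> /existsNP[a /not_implyP[ha /negP nI]]; exists a.
pose u := \prod_(A in AA) F A.
have uI : u \notin I.
  rewrite /u; elim/big_ind: _ => [|a b /negP na /negP nb|A /hF[]//].
    by have [[]] := hI.
  by apply/negP => /(prime_idealM hI)[].
pose N := rho P setT.
have uN : forall A, A \in AA -> facet_filt A N (u ^+ N).
  move=> A AAA; have FA := facet_filtration K hP AAA.
  have hu : facet_filt A 1 u.
    rewrite /u (bigD1 A) //= mulrC; apply: (filtMl FA).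
    by apply/(monomial_primeP hP _ AAA); have [] := hF A AAA.
  elim: N => [|k IH]; first exact: (filt0 FA).
  by rewrite exprS; apply: (filtM FA (k := 1%N) (l := k)).
have [|h eh hs] := @mpoly_div_monomial _ _ (toric_val (u ^+ N)) et.
  move=> m ms; apply/mnm_lepP => i; rewrite mnm1E; case: eqP => // <-.
  have /set0Pn[A AAA] := closed_inseparable_neq0 hP hn.
  have := uN A AAA m ms; rewrite /facet; have [A0 _] := rho_closedP AAA.
  have : (0 < N)%N by apply: leq_trans (rho_gt0 hP A0) (rho_subset hP (subsetT A)).
  by case: (m ord_max) => [|k]; lia.
have hR : h \in in_toric_ring P.
  apply/in_toric_ringP => // m /hs ms A AAA.
  have := uN A AAA _ ms; rewrite facetD facet_et.
  have : (rho P A <= N)%N by rewrite (rho_subset hP) ?subsetT.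
  lia.
have : u ^+ N \in I.
  have -> : u ^+ N = to_toric h * tR.
    by apply: toric_val_inj; rewrite toric_valM val_tR // to_toricK.
  exact: prime_ideal_mull.
by move/(prime_idealXn hI); apply/negP.
Qed.

(** A nonzero prime inside it contains a monomial prime, which can only be the
  same one, or the trace of a prime of K[x, t], which is not inside it. *)
Lemma monomial_prime_height_one A :
  A \in AA -> height_one_prime (monomial_prime K P A).
Proof.
move=> AAA; split; first exact: monomial_prime_prime.
  by exists tR; [apply: tR_in_monomial_prime | apply: tR_neq0].
move=> J hJ nJ JA; have [tJ|tJ] := boolP (tR \in J).
  have [B BAA BJ] := prime_over_t hJ tJ.
  have BA : B = A by apply: facet_sub => // a /BJ/JA.
  by move=> a; apply/idP/idP => [/JA//|]; rewrite -BA => /BJ.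
have [g og gJ] := prime_off_t hJ nJ tJ; have [[g0 _ _] _] := og.
by have [a /gJ/JA ->] := trace_notin_facet AAA g0.
Qed.

Lemma height_one_primeP I : height_one_prime I ->
  (exists2 A, A \in AA & monomial_prime K P A =i I) \/
  (exists2 g, off_t g & trace g =i I).
Proof.
move=> [hI nI hm]; have [tI|tI] := boolP (tR \in I).
  have [A AAA AI] := prime_over_t hI tI; left; exists A => //.
  apply: hm => //; first exact: monomial_prime_prime.
  by have [] := monomial_prime_height_one AAA.
have [g og gI] := prime_off_t hI nI tI; right; exists g => //.
by apply: hm => //; have [] := trace_height_one og.
Qed.

End ToricHeightOne.

(** * Factorization away from t *)

(** Here k' is k + 1 or k, according to whether p and g are associate. *)
Lemma prime_pow_shift (D : idomainType) (p g : D) k : prime_elt p -> prime_elt g ->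
  exists k', forall x, divides (p ^+ k) x <-> divides (p ^+ k') (x * g).
Proof.
move=> pp pg; have [p0 _ _] := pp.
have [dpg|ndpg] := pselect (divides p g).
  have [u uU eg] := prime_divides_prime pp pg dpg.
  exists k.+1 => x; rewrite eg; split=> [[c ->]|[c e]].
    by exists (c * u); rewrite exprS; ring.
  have e' : x * u = c * p ^+ k by apply: (mulIf p0); rewrite -mulrA e exprS; ring.
  by exists (c * u^-1); rewrite mulrAC -e' mulrK.
exists k => x; split=> [[c ->]|]; first by exists (c * g); ring.
by rewrite mulrC; apply: prime_pow_cancel.
Qed.

Section AwayFromT.

Variables (K : fieldType) (n : nat).
Local Notation T := {mpoly K[n.+1]}.
Local Notation t := ('X_ord_max : T).
Implicit Types (a b g u : T).

Lemma divides_t_associate g : prime_elt g -> divides g t ->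
  exists2 u, u \is a GRing.unit & g = u * t.
Proof.
move=> [_ gU _] /(mpoly_var_irreducible gU)[u uU e].
by exists u^-1; rewrite ?unitrV // e mulKr.
Qed.

Lemma prod_divides_t (s : seq T) : {in s, forall g, prime_elt g /\ divides g t} ->
  exists2 u, u \is a GRing.unit & \prod_(g <- s) g = u * t ^+ size s.
Proof.
elim: s => [|g s IH] sp; first by exists 1; rewrite ?unitr1 ?big_nil ?mulr1 ?expr0.
have [|u uU e] := IH; first by move=> x xs; apply: sp; rewrite inE xs orbT.
have [pg gt] := sp g (mem_head _ _); have [v vU ev] := divides_t_associate pg gt.
by exists (v * u); rewrite ?unitrM ?vU // big_cons e ev exprS; ring.
Qed.

(** The prime factors of a are removed one at a time: one that divides t is t up
  to a unit, and any other one divides b as well. *)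
Lemma same_multiplicities a b : a != 0 -> b != 0 ->
    (forall g k, off_t g -> (divides (g ^+ k) a <-> divides (g ^+ k) b)) ->
  exists p q u, u \is a GRing.unit /\ a * t ^+ p = u * (b * t ^+ q).
Proof.
move=> /factorial_mpoly[u [s [uU sp ->]]].
elim: s b sp => [|g s IH] b sp b0 ab.
  have [v [r [vU rp eb]]] := @factorial_mpoly K n.+1 b b0.
  have [g gr|w wU e] := @prod_divides_t r.
    split; first exact: rp.
    apply: contrapT => gt; have [_ _] := rp g gr.
    have := ab g 1%N (conj (rp g gr) gt); rewrite expr1 big_nil mulr1 => -[_ h].
    case: (prime_not_divides_unit (rp g gr) uU); apply: h; rewrite eb.
    apply: divides_mull; rewrite (perm_big _ (perm_to_rem gr)) big_cons.
    exact: divides_mulr (dividesxx _).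
  exists (size r), 0%N, (u * v^-1 * w^-1); rewrite !unitrM !unitrV uU vU wU.
  split=> //; rewrite big_nil !mulr1 eb e.
  move: (v^-1) (w^-1) (t ^+ _) (mulVr vU) (mulVr wU) => v' w' x hv hw.
  have -> : u * v' * w' * (v * (w * x)) = u * (v' * v) * (w' * w) * x by ring.
  by rewrite hv hw !mulr1.
have pg : prime_elt g by apply: sp; rewrite mem_head.
have {}sp : {in s, forall g, prime_elt g} by move=> x xs; apply: sp; rewrite inE xs orbT.
have eg : u * \prod_(j <- g :: s) j = u * \prod_(j <- s) j * g by rewrite big_cons; ring.
rewrite eg in ab *; have [gt|gt] := pselect (divides g t).
  have [v vU ev] := divides_t_associate pg gt.
  have [|p [q [w [wU e]]]] := IH b sp b0.
    move=> g' k og'; rewrite -ab //; split=> [[c ->]|].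
      by exists (c * g); ring.
    have [pg' ng't] := og'; rewrite mulrC; apply: prime_pow_cancel => //.
    by move=> g'g; apply: ng't; apply: divides_trans gt.
  exists p, q.+1, (v * w); rewrite unitrM vU wU; split=> //.
  by rewrite mulrAC e ev exprS; ring.
have [c eb] : divides g b.
  have := ab g 1%N (conj pg gt); rewrite expr1 => -[h _]; apply: h.
  exact: divides_mull (dividesxx _).
have [||p [q [w [wU e]]]] := IH c sp.
- by apply: contraNneq b0 => c0; rewrite eb c0 mul0r.
- move=> g' k og'; have [pg' _] := og'.
  have [k' hk'] := prime_pow_shift k pg' pg.
  by rewrite (hk' (u * _)) hk' -eb; apply: ab.
exists p, q, w; split=> //; rewrite mulrAC e eb; ring.
Qed.

Lemma weight_order_unit (w : 'X_{1..n.+1} -> int) u : w 0%MM = 0 ->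
  u \is a GRing.unit -> weight_order w 0 u.
Proof.
move=> w0 uU; have u0 : u != 0 by apply: contraTneq uU => ->; rewrite unitr0.
have : msize u == 1%N.
  have v0 : u^-1 != 0 by rewrite invr_eq0.
  have := congr1 (fun p => msize p) (mulrV uU); rewrite msizeM // msize1.
  have : (0 < msize u^-1)%N by rewrite lt0n msize_poly_eq0.
  have : (0 < msize u)%N by rewrite lt0n msize_poly_eq0.
  by move: (msize u) (msize u^-1) => x y; lia.
move=> /msize_poly1P[c c0 ->]; rewrite /weight_order /weight_ge msuppC (negPf c0).
by split=> [m|]; [|exists 0%MM]; rewrite ?mem_head // inE => /eqP->; rewrite w0.
Qed.

End AwayFromT.

(** * Class groups *)

Lemma pred_ext (T : Type) (I J : {pred T}) : I =i J -> I = J.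
Proof. by move=> e; apply/funext => a; apply: e. Qed.

Section QuotientFacts.

Variables (V : zmodType) (S : zmodClosed V).

(** A name for the projection under which it is an additive map by inference. *)
Definition quot_pi : V -> {ideal_quot S} := \pi_({ideal_quot S})%qT.

Lemma quot_pi_is_additive : zmod_morphism quot_pi.
Proof. by move=> x y; rewrite /quot_pi !piE. Qed.

HB.instance Definition _ :=
  GRing.isZmodMorphism.Build V {ideal_quot S} quot_pi quot_pi_is_additive.

Lemma quot_pi_eq0 x : (quot_pi x == 0) = (x \in S).
Proof. by rewrite -(raddf0 quot_pi) -[x in RHS]subr0 Quotient.idealrBE. Qed.

Lemma quot_piK (c : {ideal_quot S}) : quot_pi (repr c) = c.
Proof. exact: reprK. Qed.

Lemma repr_quot_pi x : repr (quot_pi x) - x \in S.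
Proof. by rewrite -quot_pi_eq0 raddfB /= quot_piK subrr. Qed.

Lemma quot_repr_eq (c c' : {ideal_quot S}) : repr c - repr c' \in S -> c = c'.
Proof. by rewrite -quot_pi_eq0 raddfB /= !quot_piK subr_eq0 => /eqP. Qed.

Lemma repr_quotB (c c' : {ideal_quot S}) :
  repr (c - c') - (repr c - repr c') \in S.
Proof. by have := repr_quot_pi (repr c - repr c'); rewrite raddfB /= !quot_piK. Qed.

End QuotientFacts.

Section ClassGroupFacts.

Variable R : idomainType.
Implicit Types (I J : {pred R}) (D E : weil_divisor R).

(** The representative of ideal_class; it is 0 off the height one primes. *)
Definition divisor_of I : weil_divisor R :=
  if insub (I : R -> bool) is Some Q then << (Q : prime_divisor R) >> else 0.

Lemma coeff_divisor_of I J (Q : prime_divisor R) : height_one_prime I ->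
  val Q = J -> coeff Q (divisor_of I) = `[< I = J >]%:R.
Proof.
move=> hI <-; rewrite /divisor_of; case: insubP => [Q' _ e|]; last by case/asboolP.
rewrite coeffU mul1r; congr _%:R; congr nat_of_bool; apply/eqP/asboolP => [<-//|].
by rewrite -[X in X = _]e => /val_inj.
Qed.

Lemma divisor_of_val (Q : prime_divisor R) : divisor_of (val Q) = << Q >>.
Proof.
rewrite /divisor_of; case: insubP => [Q' _ /val_inj->//|/negP[]].
by case: Q.
Qed.

Lemma is_div_principal (a : R) D : a != 0 -> is_div a D -> D \in @principal_divisors R.
Proof. by move=> a0 hD; apply/asboolP => S _ gS; apply: gS a0 hD. Qed.

End ClassGroupFacts.

(** * The class group of the toric ring *)

Section ToricClassGroup.

Variables (K : fieldType) (n : nat) (P : {fset 'X_{1..n}}).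
Hypotheses (hn : (0 < n)%N) (hP : discrete_polymatroid P).
Implicit Types (A B : {set 'I_n}) (f g h : {mpoly K[n.+1]}).
Local Notation AA := (closed_inseparable P).
Local Notation t := ('X_ord_max : {mpoly K[n.+1]}).
Local Notation R := (toric_ring K P).
Implicit Types (a b : R) (I : {pred R}) (Q : prime_divisor R) (D E : weil_divisor R).
Local Notation tR := (tR K P).
Local Notation PA := (monomial_prime K P).
Local Notation trace := (@trace K n P).
Local Notation pi := (quot_pi (@principal_divisors R)).

Lemma prime_divisorP Q :
  (exists2 A, A \in AA & val Q = PA A) \/ (exists2 g, off_t g & val Q = trace g).
Proof.
have hQ : height_one_prime (val Q) by apply/asboolP; case: Q.
have [[A AAA e]|[g og e]] := height_one_primeP hP hn hQ; [left|right].
  by exists A => //; apply: pred_ext => x; rewrite e.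
by exists g => //; apply: pred_ext => x; rewrite e.
Qed.

Lemma to_prime_divisor I : height_one_prime I -> exists Q, val Q = I.
Proof. by move=> /asboolT hI; exists (Sub (I : R -> bool) hI); rewrite SubK. Qed.

Lemma prime_divisor_filtration Q : exists2 F, valuation_filtration F &
  forall a, a \in val Q <-> F 1%N a.
Proof.
have [[A AAA ->]|[g og ->]] := prime_divisorP Q.
  by exists (facet_filt A); [apply: facet_filtration | move=> a; apply: monomial_primeP].
by exists (mult_filt g); [apply: mult_filtration | move=> a; apply: traceP].
Qed.

Lemma facet_valuation A a k : A \in AA ->
  valuation_at (PA A) a k <-> weight_order (facet P A) k%:Z (toric_val a).
Proof.
move=> AAA; rewrite facet_levelP.
exact: (center_valuation_at (facet_filtration K hP AAA)
  (fun a => monomial_primeP hP a AAA)).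
Qed.

Lemma trace_valuation g a k : off_t g -> valuation_at (trace g) a k <->
  divides (g ^+ k) (toric_val a) /\ ~ divides (g ^+ k.+1) (toric_val a).
Proof.
move=> og; have h := mult_filtration hP og.
exact: (center_valuation_at h (@traceP K n P g)).
Qed.

Lemma PA_inj A B : A \in AA -> B \in AA -> PA A = PA B -> A = B.
Proof. by move=> AAA BAA e; apply: (facet_sub (K := K) hP AAA BAA); rewrite e. Qed.

Lemma PA_neq_trace A g : A \in AA -> off_t g -> PA A <> trace g.
Proof.
move=> AAA og e; have := tR_notin_trace hP og.
by rewrite -e tR_in_monomial_prime.
Qed.

Definition facet_divisor (k : {set 'I_n} -> int) : weil_divisor R :=
  \sum_(A in AA) divisor_of (PA A) *~ k A.

Lemma coeff_facet_divisor k Q A : A \in AA -> val Q = PA A ->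
  coeff Q (facet_divisor k) = k A.
Proof.
move=> AAA eQ; rewrite raddf_sum (bigD1 A) //= raddfMz /=.
rewrite (coeff_divisor_of _ eQ); last first.
  exact: monomial_prime_height_one.
rewrite asboolT // big1 ?addr0 => [|B /andP[BAA BA]].
  by rewrite -mulrzl mulr1 intz.
rewrite raddfMz /= (coeff_divisor_of _ eQ); last exact: monomial_prime_height_one.
rewrite asboolF ?mul0rz // => e; case/eqP: BA; exact: PA_inj.
Qed.

Lemma coeff_facet_divisor_trace k Q g : off_t g -> val Q = trace g ->
  coeff Q (facet_divisor k) = 0.
Proof.
move=> og eQ; rewrite raddf_sum big1 // => A AAA.
rewrite raddfMz /= (coeff_divisor_of _ eQ); last exact: monomial_prime_height_one.
by rewrite asboolF ?mul0rz // => /PA_neq_trace; apply.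
Qed.

Lemma is_div_t : is_div tR (facet_divisor (fun A => (rho P A)%:Z)).
Proof.
move=> Q; have [[A AAA eQ]|[g og eQ]] := prime_divisorP Q.
  exists (rho P A); last by rewrite (coeff_facet_divisor _ AAA eQ).
  rewrite eQ; apply/facet_valuation => //; rewrite val_tR //.
  by rewrite -(facet_et P A); apply: weight_orderX.
exists 0%N; last by rewrite (coeff_facet_divisor_trace _ og eQ).
rewrite eQ; apply/trace_valuation => //; rewrite val_tR // expr1; split; last by case: og.
by exists t; rewrite expr0 mulr1.
Qed.

(** The prime g has multiplicity 1 at its own trace and 0 at the other ones, and
  the power of t that carries it into the toric ring changes its order at the
  monomial primes only. *)
Lemma is_div_prime g : off_t g -> exists a k,
  a != 0 /\ is_div a (divisor_of (trace g) + facet_divisor k).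
Proof.
move=> og; have [M eM] := to_toric_t hP g; set a := to_toric _ _ in eM *.
have [pg gt] := og; have [g0 gU hg] := pg.
have a0 : a != 0.
  by rewrite -val_eq0 eM mulf_neq0 ?expf_neq0 // -msupp_eq0 msuppX.
have [k hk] : exists k : {set 'I_n} -> nat, forall A, A \in AA ->
    weight_order (facet P A) (k A)%:Z (toric_val a).
  have [|k hk] := @fin_all_exists {set 'I_n} (fun=> nat) (fun A k => A \in AA ->
      weight_order (facet P A) k%:Z (toric_val a)); last by exists k.
  move=> A; have [AAA|_] := boolP (A \in AA); last by exists 0%N.
  by have [k ?] := facet_order hP AAA a0; exists k.
exists a, (fun A => (k A)%:Z); split=> // Q.
have htr := trace_height_one hP og.
have [[A AAA eQ]|[g' og' eQ]] := prime_divisorP Q.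
  exists (k A); first by rewrite eQ; apply/facet_valuation => //; apply: hk.
  rewrite raddfD /= (coeff_facet_divisor _ AAA eQ) (coeff_divisor_of htr eQ).
  by rewrite asboolF ?add0r // => /esym; apply: PA_neq_trace.
rewrite raddfD /= (coeff_facet_divisor_trace _ og' eQ) addr0 (coeff_divisor_of htr eQ) eQ.
have tM f : divides f g -> divides f (g * t ^+ M) by apply: divides_mulr.
have [[g'0 g'U hg'] _] := og'.
have [/asboolP e|/asboolP ne] := boolP (`[< trace g = trace g' >]).
  exists 1%N => //; rewrite -e; apply/trace_valuation => //; rewrite eM expr1 expr2.
  split; first exact: tM (dividesxx _).
  move=> [c ec]; apply: (off_t_pow (k := M) og); exists c; apply: (mulfI g0).
  by rewrite ec; ring.
exists 0%N => //; apply/trace_valuation => //; rewrite expr0 expr1 eM; split.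
  by exists (g * t ^+ M); rewrite mulr1.
move=> /hg'[|/off_t_pow]; last exact.
move=> /(prime_divides_prime og'.1 pg)[u uU eg]; case: ne.
by apply: pred_ext => x; rewrite eg trace_unit.
Qed.

Lemma facet_divisor_class k :
  pi (facet_divisor k) = \sum_(A in AA) ideal_class (PA A) *~ k A.
Proof. by rewrite raddf_sum; apply: eq_bigr => A _; rewrite raddfMz. Qed.

(** By is_div_prime the class of a trace is minus a combination of the classes of
  the monomial primes. *)
Lemma classes_generate (c : Cl R) : exists k : {set 'I_n} -> int,
  c = \sum_(A in AA) ideal_class (PA A) *~ k A.
Proof.
pose S (c : Cl R) := exists k, c = pi (facet_divisor k).
have facetN k : - facet_divisor k = facet_divisor (fun A => - k A).
  by rewrite -sumrN; apply: eq_bigr => A _; rewrite mulrNz.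
have facetDk k l : facet_divisor k + facet_divisor l = facet_divisor (fun A => k A + l A).
  by rewrite -big_split; apply: eq_bigr => A _; rewrite mulrzDr.
have S0 : S 0.
  exists (fun=> 0); apply/esym; rewrite -(raddf0 pi); congr (pi _).
  by rewrite /facet_divisor big1 // => A _; rewrite mulr0z.
have SD x y : S x -> S y -> S (x + y).
  by move=> [k ->] [l ->]; exists (fun A => k A + l A); rewrite -facetDk raddfD.
have SN x : S x -> S (- x).
  by move=> [k ->]; exists (fun A => - k A); rewrite -facetN raddfN.
have SQ Q : S (pi << Q >>).
  rewrite -divisor_of_val; have [[A AAA ->]|[g og ->]] := prime_divisorP Q.
    exists (fun B => (B == A)%:Z); congr (pi _).
    rewrite /facet_divisor (bigD1 A) //= eqxx mulr1z big1 ?addr0 // => B /andP[_ /negPf->].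
    by rewrite mulr0z.
  have [a [k [a0 /(is_div_principal a0)]]] := is_div_prime og.
  rewrite -quot_pi_eq0 raddfD addr_eq0 => /eqP->; apply: SN; by exists k.
rewrite -[c]quot_piK; move: (repr c) => D.
have [k ->] : S (pi D); last by exists k; apply: facet_divisor_class.
rewrite -[D]freeg_sumE raddf_sum; elim/big_ind: _ => // Q _.
have -> : << coeff Q D *g Q >> = << Q >> *~ coeff Q D :> weil_divisor R.
  by rewrite freegU_mulz intz.
rewrite raddfMz; case: (coeff Q D) => k; rewrite ?NegzE ?mulrNz; last apply: SN.
  elim: k => [|k IH]; rewrite ?mulr0z //.
  by rewrite -pmulrn mulrS; apply: SD; [apply: SQ | apply: IH].
elim: k.+1 => {k} [|k IH]; rewrite ?mulr0z //.
by rewrite -pmulrn mulrS; apply: SD; [apply: SQ | apply: IH].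
Qed.

(** A multiple of the divisor of t. *)
Lemma rho_relation (m : int) :
  \sum_(A in AA) ideal_class (PA A) *~ (m * (rho P A)%:Z) = 0.
Proof.
have := is_div_principal (tR_neq0 K hP) is_div_t.
rewrite -quot_pi_eq0 facet_divisor_class => /eqP e.
transitivity ((\sum_(A in AA) ideal_class (PA A) *~ (rho P A)%:Z) *~ m).
  by rewrite mulrz_suml; apply: eq_bigr => A _; rewrite -mulrzA mulrC.
by rewrite e mul0rz.
Qed.

(** A principal divisor supported on the monomial primes comes from a quotient
  a / b without zeros and poles away from t, that is, from a power of t up to a
  unit of K[x, t]. *)
Lemma only_rho_relation (k : {set 'I_n} -> int) :
  \sum_(A in AA) ideal_class (PA A) *~ k A = 0 ->
  exists m : int, forall A, A \in AA -> k A = m * (rho P A)%:Z.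
Proof.
rewrite -facet_divisor_class => /eqP; rewrite quot_pi_eq0 => /asboolP h.
pose S : {pred weil_divisor R} := fun E => `[< exists a b, [/\ a != 0, b != 0
  & forall Q, exists i j, [/\ valuation_at (val Q) a i, valuation_at (val Q) b j
      & coeff Q E = i%:Z - j%:Z]] >].
have lvl Q a : a != 0 -> exists i, valuation_at (val Q) a i.
  by have [F hF hQ] := prime_divisor_filtration Q; apply: (valuation_at_exists hF hQ).
have vM Q a b i j : valuation_at (val Q) a i -> valuation_at (val Q) b j ->
    valuation_at (val Q) (a * b) (i + j).
  by have [F hF hQ] := prime_divisor_filtration Q; apply: (valuation_atM hF hQ).
have /asboolP[a [b [a0 b0 hab]]] : facet_divisor k \in S.
  apply: h.
    split=> [|x y /asboolP[a [b [a0 b0 hx]]] /asboolP[c [d [c0 d0 hy]]]]; apply/asboolP.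
      exists 1, 1; split; rewrite ?oner_neq0 // => Q.
      have [i hi] := lvl Q 1 (oner_neq0 _); exists i, i; split=> //.
      by rewrite subrr coeff0.
    exists (a * d), (b * c); rewrite !mulf_neq0 //; split=> // Q.
    have [i [j [hi hj ex]]] := hx Q; have [i' [j' [hi' hj' ey]]] := hy Q.
    exists (i + j')%N, (j + i')%N.
    split; [exact: (vM Q a d i j' hi hj') | exact: (vM Q b c j i' hj hi') |].
    by rewrite raddfB /= ex ey !PoszD; ring.
  move=> a E a0 hE; apply/asboolP; exists a, 1; split; rewrite ?oner_neq0 // => Q.
  have [i hi ei] := hE Q; exists i, 0%N; split; [exact: hi | | by rewrite ei subr0].
  have [F hF hQ] := prime_divisor_filtration Q; apply/(center_valuation_at hF hQ).
  by split; [apply: (filt0 hF) | apply: (filt_one hF)].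
have [||g j og|p [q [u [uU e]]]] := @same_multiplicities K n (toric_val a) (toric_val b).
- by rewrite val_eq0.
- by rewrite val_eq0.
- have [Q eQ] := to_prime_divisor (trace_height_one hP og).
  have [i [j' []]] := hab Q; rewrite eQ (coeff_facet_divisor_trace _ og eQ).
  move=> /(trace_valuation _ _ og)[ha na] /(trace_valuation _ _ og)[hb nb] eij.
  have eij' : i = j' by lia.
  rewrite -{}eij' in hb nb; have hF := mult_filtration hP og.
  have iff (x : R) : mult_filt g i x -> ~ mult_filt g i.+1 x ->
      (mult_filt g j x <-> (j <= i)%N).
    move=> h1 h2; split=> [hj|le]; last by apply: (filt_le hF le).
    by apply: (filt_level_leq hF) h2.
  by have := iff a ha na; have := iff b hb nb; rewrite /mult_filt; tauto.
exists (q%:Z - p%:Z) => A AAA.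
have [Q eQ] := to_prime_divisor (monomial_prime_height_one K hP hn AAA).
have [i [j []]] := hab Q; rewrite eQ (coeff_facet_divisor _ AAA eQ).
move=> /(facet_valuation _ _ AAA) ha /(facet_valuation _ _ AAA) hb ->.
have fD := @facetD n P A.
have ht r : weight_order (facet P A) ((rho P A)%:Z * r%:Z) (t ^+ r).
  by rewrite mpolyXn -facet_et -facet_mulmn; apply: weight_orderX.
have := weight_orderM fD ha (ht p); rewrite e => h1.
have := weight_orderM fD (weight_order_unit (facet0 P A) uU) (weight_orderM fD hb (ht q)).
by move=> /(weight_order_uniq h1); lia.
Qed.

End ToricClassGroup.

(** * Abelian groups with a single relation *)

(** Smith normal form puts the relation vector c into the shape e * R_0 with R_0
  the first row of a unimodular matrix R; in the basis of the rows of R the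
  quotient by c is visibly a sum of one cyclic group and copies of the integers. *)
Lemma one_relation_quotient (C : zmodType) r (x : 'I_r -> C) (c : 'I_r -> int) :
    (0 < r)%N ->
    (forall y, exists k : 'I_r -> int, y = \sum_i x i *~ k i) ->
    (forall k : 'I_r -> int, \sum_i x i *~ k i = 0 <->
       exists m, forall i, k i = m * c i) ->
  exists f : {additive
      ('rV[int]_r.-1 * int_mod (\big[gcdn/0]_(i < r) `|c i|)%N)%type -> C},
    bijective f.
Proof.
case: r x c => // r x c _ gen rel; set d := (\big[gcdn/0]_(i < r.+1) `|c i|)%N.
have [L Lu [M Mu [ds _ e0]]] := int_Smith_normal_form (\row_i c i : 'rV[int]_(1 + r)).
pose e : int := L 0 0 * ds`_0.
have cE i : c i = e * M 0 i.
  have := congr1 (fun N : 'rV_(1 + r) => N 0 i) e0; rewrite mxE => ->.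
  rewrite -mulmxA mxE big_ord1 mxE /e -mulrA; congr (_ * _).
  rewrite (bigD1 0) //= mxE eqxx mulr1n big1 ?addr0 // => j j0.
  rewrite mxE -[_ == _ :> nat]/(0%N == j) eq_sym -[0%N]/(val (0 : 'I_(1 + r))).
  by rewrite (inj_eq val_inj) (negPf j0) mul0r.
have ed : `|e|%N = d.
  apply/eqP; rewrite eqn_dvd; apply/andP; split.
    rewrite /d; elim/big_ind: _ => [|a b ha hb|i _]; first exact: dvdn0.
      by rewrite dvdn_gcd ha hb.
    by rewrite -dvdzE cE dvdz_mulr.
  rewrite -[d]/`|d%:Z|%N -dvdzE.
  have -> : e = \sum_i c i * invmx M i 0.
    have := congr1 (fun N : 'M_(1 + r) => e * N 0 0) (mulmxV Mu).
    rewrite !mxE eqxx mulr1 => <-; rewrite mulr_sumr; apply: eq_bigr => i _.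
    by rewrite cE mulrA.
  apply: rpred_sum => i _; apply: dvdz_mulr; rewrite dvdzE.
  exact: (biggcdn_inf i).
pose phi (u : 'rV[int]_(1 + r)) : C := \sum_i x i *~ (u *m M) 0 i.
have phiD u v : phi (u - v) = phi u - phi v.
  rewrite /phi -sumrB mulmxBl; move: (u *m M) (v *m M) => a b.
  by apply: eq_bigr => i _; rewrite !mxE mulrzBr.
have rowM a i : (row_mx a%:M (0 : 'rV_r) *m M) 0 i = a * M 0 i.
  rewrite -[M in LHS](@vsubmxK _ 1 r) mul_row_col mul0mx addr0 mul_scalar_mx !mxE.
  by congr (_ * M _ _); apply: val_inj.
have phi0 v n : phi (row_mx n%:M v) = 0 <-> v = 0 /\ (e %| n)%Z.
  rewrite rel; split=> [[m hm]|[-> /dvdzP[m ->]]].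
    have h : row_mx n%:M v = row_mx (m * e)%:M 0 :> 'rV[int]_(1 + r).
      by apply: (can_inj (mulmxK Mu)); apply/rowP => i; rewrite hm cE mulrA rowM.
    have [hn ->] := eq_row_mx h; split=> //.
    have := congr1 (fun N : 'M_1 => N 0 0) hn; rewrite !mxE eqxx !mulr1n => ->.
    exact: dvdz_mull.
  by exists m => i; rewrite rowM cE mulrA.
have phi_surj y : exists v n, y = phi (row_mx n%:M v).
  have [k ->] := gen y; pose u := (\row_i k i) *m invmx M.
  exists (rsubmx (u : 'rV_(1 + r))), (u 0 0).
  have -> : row_mx (u 0 0)%:M (rsubmx (u : 'rV_(1 + r))) = u.
    rewrite -[RHS]hsubmxK; congr row_mx; rewrite [RHS]mx11_scalar; congr _%:M.
    by rewrite [RHS]mxE; congr (u _ _); apply: val_inj.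
  by apply: eq_bigr => i _; rewrite mulmxKV // mxE.
have dvde z : (z \in dvdz d%:Z) = (e %| z)%Z.
  by rewrite -[z \in _]/(d%:Z %| z)%Z !dvdzE ed.
pose f (p : 'rV[int]_r * int_mod d) : C := phi (row_mx (repr p.2)%:M p.1).
have fadd : zmod_morphism f.
  move=> p q; rewrite /f -phiD; apply/eqP; rewrite -subr_eq0 -phiD; apply/eqP.
  rewrite opp_row_mx add_row_mx opp_row_mx add_row_mx subrr -!raddfB /=.
  by apply/phi0; split=> //; rewrite -dvde; apply: repr_quotB.
pose fA : {additive ('rV[int]_r * int_mod d)%type -> C} :=
  HB.pack f (GRing.isZmodMorphism.Build _ _ f fadd).
exists fA.
have finj : injective f.
  move=> [v z] [v' z'] /eqP; rewrite -subr_eq0 /f -phiD => /eqP /=.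
  rewrite opp_row_mx add_row_mx -raddfB => /phi0[/eqP]; rewrite subr_eq0 => /eqP->.
  by rewrite -dvde => /quot_repr_eq->.
have fsurj y : exists p, f p = y.
  have [v [n ->]] := phi_surj y; exists (v, quot_pi _ n); apply/eqP.
  rewrite -subr_eq0 /f -phiD opp_row_mx add_row_mx subrr -raddfB; apply/eqP/phi0.
  by split=> //; rewrite -dvde; apply: repr_quot_pi.
have [g gK] := choice fsurj.
by exists g => [p|y]; [apply: finj; rewrite [LHS]gK | exact: gK].
Qed.

(** * The presentation of the class group *)

Theorem theorem3p3 (K : fieldType) (n : nat) (P : {fset 'X_{1..n}})
    (hn : (0 < n)%N) (hP : discrete_polymatroid P) :
  let R : idomainType := toric_ring K P in
  let AA : {set {set 'I_n}} := closed_inseparable P in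
  let cls (A : {set 'I_n}) : Cl R := ideal_class (monomial_prime K P A) in
  let d : nat := (\big[gcdn/0]_(A in AA) rho P A)%N in
  [/\ (* each P_A is a height one prime ideal *)
      forall A, A \in AA -> height_one_prime (monomial_prime K P A),
      (* the classes [P_A] generate Cl(R) *)
      forall c : Cl R, exists k : {set 'I_n} -> int,
        c = \sum_(A in AA) cls A *~ k A,
      (* the relations among them are the multiples of sum rho(A) [P_A] = 0 *)
      forall k : {set 'I_n} -> int,
        \sum_(A in AA) cls A *~ k A = 0 <->
        exists m : int, forall A, A \in AA -> k A = m * (rho P A)%:Z
    & exists f : {additive ('rV[int]_(#|AA|.-1) * int_mod d)%type -> Cl R},
        bijective f].
Proof.
move=> R AA cls d.
have rel k : \sum_(A in AA) cls A *~ k A = 0 <->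
    exists m : int, forall A, A \in AA -> k A = m * (rho P A)%:Z.
  split=> [/(only_rho_relation hn hP)//|[m hm]].
  transitivity (\sum_(A in AA) cls A *~ (m * (rho P A)%:Z)).
    by apply: eq_bigr => A /hm->.
  exact: rho_relation.
split=> // [A AAA|c|].
- exact: monomial_prime_height_one.
- exact: classes_generate.
have /set0Pn[A0 A0A] := closed_inseparable_neq0 hP hn.
have sumE (k : {set 'I_n} -> int) :
    \sum_(A in AA) cls A *~ k A = \sum_(i < #|AA|) cls (enum_val i) *~ k (enum_val i).
  exact: big_enum_val.
have -> : d = (\big[gcdn/0]_(i < #|AA|) `|(rho P (enum_val i))%:Z|)%N.
  by rewrite /d big_enum_val.
apply: (one_relation_quotient (x := fun i => cls (enum_val i))).
- by apply/card_gt0P; exists A0.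
- move=> y; have [k ->] := classes_generate hn hP y.
  by exists (fun i => k (enum_val i)); rewrite sumE.
move=> k; pose k' A := k (enum_rank_in A0A A).
have -> : \sum_i cls (enum_val i) *~ k i = \sum_(A in AA) cls A *~ k' A.
  by rewrite sumE; apply: eq_bigr => i _; rewrite /k' enum_valK_in.
rewrite rel; split=> -[m hm]; exists m.
  by move=> i; rewrite -hm ?enum_valP // /k' enum_valK_in.
by move=> A AAA; rewrite /k' hm enum_rankK_in.
Qed.
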